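(* Let $q\in(0,1)$, $w>0$, $c\in\mathbb R$, $\sigma>0$, let $\mathcal D=\left[-\frac{w}{1-q},\frac{w}{1-q}\right]$, and let $(D_k)_{k\ge 0}$ be the error process $D_k=\widehat X_k-X_k$ of the One State Algorithm, with transition kernel $P$ on $\mathcal D$ and conditional error probability $g$ (all defined in the context). If $$\frac{c^2w^2}{\sigma^2}>4 \ \text{ and } \ q<\frac{1}{3+\sqrt{\frac{2}{e\pi}}},\qquad\text{or if}\qquad \frac{c^2w^2}{\sigma^2}\le 4 \ \text{ and } \ q\le \frac{1}{1+\sqrt{\frac{2}{e\pi}}},$$ then $$\lim_{K\to\infty}\mathrm{MSE}_K=\int_{\mathcal D} g\,\mathrm d\mu\qquad\text{for any } D_0\in\mathcal D,$$ where $\mathrm{MSE}_K=\frac1K\sum_{k=0}^{K-1}\mathbb E\big[(U_k-\widehat U_k)^2\big]$ and $\mu$ is the unique probability measure on $(\mathcal D,\mathcal B(\mathcal D))$ such that $$\sup_{x\in\mathcal D} d_W\big(P^k(x,\cdot),\mu(\cdot)\big)\longrightarrow 0\quad\text{as } k\to\infty.$$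
   Context: System. Let $U_0,U_1,\dots$ be independent Bernoulli$(1/2)$ random variables with values in $\{0,1\}$ and $N_1,N_2,\dots$ independent Gaussian random variables with mean $0$ and variance $\sigma^2$, the two families being mutually independent. For $k\ge 1$ set $X_k=qX_{k-1}+wU_{k-1}$ and $Y_k=cX_k+N_k$, with $X_0=0$. One State Algorithm. Starting from an initial state estimate $\widehat X_0$ (deterministic), for $k\ge1$ set $$\widehat U_{k-1}=\mathbf 1_{\left(cq\widehat X_{k-1}+\frac{cw}{2},\,+\infty\right)}(Y_k),\qquad \widehat X_k=q\widehat X_{k-1}+w\widehat U_{k-1}.$$ Error process. $D_k=\widehat X_k-X_k$ satisfies $D_k=qD_{k-1}+w(\widehat U_{k-1}-U_{k-1})$ for $k\ge1$, with initial state $D_0=\widehat X_0-X_0$. It is a Markov process on $\mathcal D$ when $D_0\in\mathcal D$: from state $z$ it moves to one of $qz+w,\ qz-w,\ qz$, with transition probabilities $$P(z,qz+w)=\tfrac14\operatorname{erfc}\!\left(\frac{cqz+cw/2}{\sigma\sqrt2}\right),\quad P(z,qz-w)=\tfrac14\operatorname{erfc}\!\left(\frac{-cqz+cw/2}{\sigma\sqrt2}\right),$$ $$P(z,qz)=1-P(z,qz+w)-P(z,qz-w),$$ where $\operatorname{erfc}(x)=\frac{2}{\sqrt\pi}\int_x^{+\infty}e^{-t^2}\,\mathrm dt$. $\mathcal B(\mathcal D)$ is the Borel $\sigma$-field of $\mathcal D$ and $P^k$ denotes the $k$-step transition kernel. Define $$g(z)=\mathrm P(\widehat U_k\ne U_k\mid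 D_k=z)=P(z,qz+w)+P(z,qz-w),\quad z\in\mathcal D,$$ which does not depend on $k$. Kantorovich (Wasserstein) distance between probability measures on $\mathcal D$: $d_W(\mu,\nu)=\sup_f\left|\int_{\mathcal D} f\,\mathrm d(\mu-\nu)\right|$, the supremum being over all functions $f:\mathcal D\to\mathbb R$ that are Lipschitz with constant $1$. *)

(* Defs.v *)
From HB Require Import structures.
From mathcomp Require Import all_boot all_order all_algebra.
From mathcomp Require Import all_classical all_reals all_analysis.
From mathcomp Require Import measurable_realfun lra.

Set Implicit Arguments.
Unset Strict Implicit.
Unset Printing Implicit Defensive.

Import Order.TTheory GRing.Theory Num.Theory.
Import numFieldNormedType.Exports.

Local Open Scope classical_set_scope.
Local Open Scope ring_scope.

Section erfc.
Context {R : realType}.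
Local Notation leb := (@lebesgue_measure R).

Definition erfc (x : R) : R :=
  2 / Num.sqrt pi * \int[leb]_(t in `[x, +oo[) expR (- t ^+ 2).

Lemma integrable_gauss_tail x :
  leb.-integrable `[x, +oo[ (fun t : R => (expR (- t ^+ 2))%:E).
Proof.
by apply: (@integrableS _ _ _ _ setT) => //; exact: integrableT_gauss.
Qed.

Lemma gauss_tail_fin_num x :
  (\int[leb]_(t in `[x, +oo[) (expR (- t ^+ 2))%:E)%E \is a fin_num.
Proof. exact: (integrable_fin_num _ (integrable_gauss_tail x)). Qed.

Lemma erfc_ge0 (x : R) : 0 <= erfc x.
Proof.
rewrite mulr_ge0 ?divr_ge0 ?sqrtr_ge0//.
by apply: Rintegral_ge0 => t _; exact: expR_ge0.
Qed.

Lemma erfc_nonincreasing : {homo erfc : x y / x <= y >-> y <= x}.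
Proof.
move=> x y xy; rewrite ler_wpM2l ?divr_ge0 ?sqrtr_ge0//.
apply: fine_le; [exact: gauss_tail_fin_num..|].
apply: ge0_subset_integral => //=.
- apply/measurable_EFinP; apply: measurable_funTS; exact: measurable_gauss_fun.
- by apply: subset_itvr; rewrite bnd_simp.
Qed.

Lemma erfc_le2 (x : R) : erfc x <= 2.
Proof.
rewrite /erfc -mulrA -[leRHS]mulr1 ler_pM2l// mulrC.
rewrite ler_pdivrMr ?sqrtr_gt0 ?pi_gt0// mul1r.
rewrite -[leRHS]/(fine (Num.sqrt pi)%:E) -integralT_gauss.
apply: fine_le; [exact: gauss_tail_fin_num|by rewrite integralT_gauss|].
apply: ge0_subset_integral => //=.
by apply/measurable_EFinP; exact: measurable_gauss_fun.
Qed.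

Lemma measurable_erfc : measurable_fun [set: R] erfc.
Proof.
by apply: nonincreasing_measurable => // x y xy; exact: erfc_nonincreasing.
Qed.

End erfc.

Section system.
Context {R : realType} {T : Type} (q w c : R).

(* U k is the k-th input bit; N k is used for k >= 1 only. *)
Variables (U : nat -> T -> bool) (N : nat -> T -> R).

Fixpoint state (k : nat) (t : T) : R :=
  if k is k'.+1 then q * state k' t + w * (U k' t)%:R else 0.

Definition output (k : nat) (t : T) : R := c * state k t + N k t.

Definition decide (xh y : R) : R :=
  \1_(`](c * q * xh + c * w / 2), +oo[ : set R) y.

Fixpoint state_est (xh0 : R) (k : nat) (t : T) : R :=
  if k is k'.+1 then
    q * state_est xh0 k' t + w * decide (state_est xh0 k' t) (output k'.+1 t)
  else xh0.

Definition input_est (xh0 : R) (k : nat) (t : T) : R :=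
  decide (state_est xh0 k t) (output k.+1 t).

Definition err (xh0 : R) (k : nat) (t : T) : R :=
  state_est xh0 k t - state k t.

End system.

Definition mse {d : measure_display} {R : realType} {T : measurableType d}
    (P : probability T R) (q w c : R)
    (U : nat -> {RV P >-> bool}) (N : nat -> {RV P >-> R}) (xh0 : R) (K : nat)
  : \bar R :=
  let Uh := input_est q w c (fun k => U k) (fun k => N k) xh0 in
  ((K%:R^-1)%:E *
   \sum_(0 <= k < K) 'E_P[fun t => (((U k t)%:R - Uh k t) ^+ 2)%R])%E.

(* The kernel is defined by its formula on the whole line; by error_kernel_dom
   it leaves the interval error_dom invariant, and only its values from starting
   points in error_dom are used. *)
Section error_kernel.
Context {R : realType} (q w c sigma : R).

Definition error_dom : set R := `[- (w / (1 - q)), w / (1 - q)].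

Definition prob_up (z : R) : R :=
  4^-1 * erfc ((c * q * z + c * w / 2) / (sigma * Num.sqrt 2)).

Definition prob_down (z : R) : R :=
  4^-1 * erfc ((- (c * q * z) + c * w / 2) / (sigma * Num.sqrt 2)).

Definition prob_stay (z : R) : R := 1 - prob_up z - prob_down z.

Definition cond_err (z : R) : R := prob_up z + prob_down z.

Lemma prob_up_ge0 z : 0 <= prob_up z.
Proof. by rewrite mulr_ge0// erfc_ge0. Qed.

Lemma prob_down_ge0 z : 0 <= prob_down z.
Proof. by rewrite mulr_ge0// erfc_ge0. Qed.

Lemma prob_stay_ge0 z : 0 <= prob_stay z.
Proof.
rewrite /prob_stay /prob_up /prob_down -addrA -opprD subr_ge0 -mulrDr.
rewrite mulrC ler_pdivrMr// mul1r (_ : 4 = 2 + 2); last by rewrite -natrD.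
by rewrite lerD// erfc_le2.
Qed.

Lemma measurable_prob_up : measurable_fun [set: R] prob_up.
Proof.
apply: measurable_funM => //; apply: measurableT_comp.
  exact: measurable_erfc.
by apply: measurable_funM => //; apply: measurable_funD => //;
  exact: measurable_funM.
Qed.

Lemma measurable_prob_down : measurable_fun [set: R] prob_down.
Proof.
apply: measurable_funM => //; apply: measurableT_comp.
  exact: measurable_erfc.
apply: measurable_funM => //; apply: measurable_funD => //.
by apply: measurableT_comp => //; exact: measurable_funM.
Qed.

Lemma measurable_prob_stay : measurable_fun [set: R] prob_stay.
Proof.
apply: measurable_funB; last exact: measurable_prob_down.
by apply: measurable_funB => //; exact: measurable_prob_up.
Qed.

Definition error_kernel (z : R) : {measure set R -> \bar R} :=
  measure_add
    (measure_add (mscale (NngNum (prob_up_ge0 z)) \d_(q * z + w))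
                 (mscale (NngNum (prob_down_ge0 z)) \d_(q * z - w)))
    (mscale (NngNum (prob_stay_ge0 z)) \d_(q * z)).

Lemma error_kernelE z A : error_kernel z A =
  ((prob_up z)%:E * \d_(q * z + w)%R A +
   (prob_down z)%:E * \d_(q * z - w)%R A +
   (prob_stay z)%:E * \d_(q * z)%R A)%E.
Proof.
by rewrite [LHS]measure_addE; congr (_ + _)%E; rewrite [LHS]measure_addE.
Qed.

Lemma measurable_error_kernel A : measurable A ->
  measurable_fun [set: R] (error_kernel ^~ A).
Proof.
move=> mA; under eq_fun do rewrite error_kernelE.
have mdirac (f : R -> R) : measurable_fun [set: R] f ->
    measurable_fun [set: R] (fun z => \d_(f z) A : \bar R).
  move=> mf; apply/measurable_EFinP.
  by apply: measurableT_comp mf; exact: measurable_indic.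
apply: emeasurable_funD; first apply: emeasurable_funD.
- apply: emeasurable_funM;
    first by apply/measurable_EFinP; exact: measurable_prob_up.
  by apply: mdirac; apply: measurable_funD => //; exact: measurable_funM.
- apply: emeasurable_funM;
    first by apply/measurable_EFinP; exact: measurable_prob_down.
  by apply: mdirac; apply: measurable_funB => //; exact: measurable_funM.
- apply: emeasurable_funM;
    first by apply/measurable_EFinP; exact: measurable_prob_stay.
  by apply: mdirac; exact: measurable_funM.
Qed.

HB.instance Definition _ := isKernel.Build _ _ _ _ _ error_kernel
  measurable_error_kernel.

Lemma error_kernel_setT z : error_kernel z [set: R] = 1%E.
Proof.
rewrite error_kernelE !diracT !mule1 -!EFinD; congr EFin.
have -> : prob_stay z = 1 - (prob_up z + prob_down z).
  by rewrite opprD addrA.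
by rewrite [LHS]addrC subrK.
Qed.

HB.instance Definition _ := Kernel_isProbability.Build _ _ _ _ _
  error_kernel error_kernel_setT.

Lemma error_kernel_dom z : 0 < q -> q < 1 -> 0 < w ->
  error_dom z -> error_kernel z error_dom = 1%E.
Proof.
move=> q0 q1 w0; rewrite /error_dom /= in_itv /= => /andP[z1 z2].
have bE : w = w / (1 - q) - q * (w / (1 - q)).
  by rewrite -[X in X - _]mul1r -mulrBl mulrC divfK// subr_eq0 gt_eqF.
have qz1 : q * - (w / (1 - q)) <= q * z by rewrite ler_pM2l.
have qz2 : q * z <= q * (w / (1 - q)) by rewrite ler_pM2l.
set b := w / (1 - q) in bE qz1 qz2 z1 z2 *.
have dom1 y : `|y - q * z| <= w -> \d_y `[- b, b]%classic = 1%E :> \bar R.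
  rewrite ler_distl => /andP[y1 y2].
  rewrite diracE mem_set//= in_itv/=; apply/andP; split.
    by rewrite mulrN in qz1; lra.
  by lra.
have dup : \d_(q * z + w) `[- b, b]%classic = 1%E :> \bar R.
  by apply: dom1; rewrite addrAC subrr add0r ger0_norm// ltW.
have ddown : \d_(q * z - w) `[- b, b]%classic = 1%E :> \bar R.
  by apply: dom1; rewrite addrAC subrr add0r normrN ger0_norm// ltW.
have dstay : \d_(q * z) `[- b, b]%classic = 1%E :> \bar R.
  by apply: dom1; rewrite subrr normr0 ltW.
rewrite error_kernelE dup ddown dstay.
have := error_kernel_setT z.
by rewrite error_kernelE !diracT.
Qed.

Fixpoint error_kernel_iter (k : nat) : R.-spker R ~> R :=
  if k is k'.+1 then mkcomp_noparam (error_kernel_iter k') error_kernel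
  else kdirac (@measurable_id _ R setT).

End error_kernel.

(* A probability measure on the Borel subsets of D is represented by a
   probability measure m on R with m D = 1. *)
Definition kantorovich {R : realType} (D : set R)
    (m1 m2 : {measure set R -> \bar R}) : \bar R :=
  ereal_sup
    [set `|(\int[m1]_(x in D) (f x)%:E) - (\int[m2]_(x in D) (f x)%:E)|%E
    | f in [set f : R -> R | 1.-lipschitz_D f]].

Definition cvg_kantorovich {R : realType} (D : set R)
    (Pk : nat -> R -> {measure set R -> \bar R})
    (m : {measure set R -> \bar R}) : Prop :=
  ereal_sup [set kantorovich D (Pk k x) m | x in D] @[k --> \oo] --> 0%E.

Section independence.
Context {d : measure_display} {R : realType} {T : measurableType d}
  (P : probability T R).
Local Open Scope ereal_scope.

Definition independent_rvs {d' : measure_display} {T' : measurableType d'}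
    (X : nat -> T -> T') : Prop :=
  forall (J : seq nat) (E : nat -> set T), uniq J ->
    (forall i, i \in J -> g_sigma_algebra_preimage (X i) (E i)) ->
    P (\bigcap_(i in [set` J]) E i) = \prod_(i <- J) P (E i).

Definition gen_sigma_algebra {d' : measure_display} {T' : measurableType d'}
    (X : nat -> T -> T') : set (set T) :=
  <<s \bigcup_i g_sigma_algebra_preimage (X i) >>.

Definition independent_families {d1 d2 : measure_display}
    {T1 : measurableType d1} {T2 : measurableType d2}
    (X : nat -> T -> T1) (Y : nat -> T -> T2) : Prop :=
  forall A B, gen_sigma_algebra X A -> gen_sigma_algebra Y B ->
    P (A `&` B) = P A * P B.

End independence.

(* Main.v *)
(** On functions of the error, one step of the chain acts by the operator
[A f z = \sum_y P(z, y) f y].  All moves contract distances by [q] and the jump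
probabilities are Lipschitz, so the Lipschitz constants of [A^k f] stay bounded.
From any two starting points both chains jump up together with probability at
least some [delta > 0], and [n] joint jumps multiply their distance by [q^n];
hence the oscillation of [A^k f] tends to [0] uniformly over 1-Lipschitz [f], for
every [q < 1].  The limit of [A^k f] is a positive normalised functional of [f];
its values on ramps give the distribution function of [mu], and piecewise linear
interpolation shows that it is the integral against [mu].  Finally, on the events
prescribing the first [k] bits and decisions the error [D_k] is constant, so
[P(U_k <> Uh_k) = A^k g (D_0)], which tends to the integral of [g]; conclude by
Cesaro averaging. *)
Require Import Defs.
From HB Require Import structures.
From mathcomp Require Import all_boot all_order all_algebra.
From mathcomp Require Import all_classical all_reals all_analysis.
From mathcomp Require Import measurable_realfun ring lra.

Set Implicit Arguments.
Unset Strict Implicit.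
Unset Printing Implicit Defensive.

Import Order.TTheory GRing.Theory Num.Theory.
Import numFieldNormedType.Exports.

Local Open Scope classical_set_scope.
Local Open Scope ring_scope.

(** * The transition operator and its mixing *)

(** Total variation is out of reach: after [k] steps the law from a given point is carried by
    finitely many points, and two starting points need not share any of them. Nor must one step
    lower the Lipschitz constant, since the jump probabilities have slope up to [prob_lip], which is
    proportional to [|c| * q / sigma]. Hence two seminorms are tracked together: from a Lipschitz
    constant [L] and an oscillation [M], [transfer] produces at most [q * L + 2 * kp * M] and [M],
    and it is the oscillation that is made small. The estimates are homogeneous in [L] and uniform
    in the starting point, so one iteration number serves all test functions and all starting
    points, as the two suprema require. The limit functional is controlled on Lipschitz functions
    only, so indicators are replaced by ramps. On the probability space, the role of the Markov
    property is taken by cylinder events: once the past state and estimate are constants, fixing a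
    bit and a decision constrains one [U k] and one [N k.+1] separately, and independence becomes a
    product formula. *)

Definition lip_ball {R : realType} (r L : R) (f : R -> R) : Prop :=
  forall x y : R, `|x| <= r -> `|y| <= r -> `|f x - f y| <= L * `|x - y|.

Definition osc_ball {R : realType} (r M : R) (f : R -> R) : Prop :=
  forall x y : R, `|x| <= r -> `|y| <= r -> `|f x - f y| <= M.

Section transfer.
Context {R : realType} (q w : R) (pu pd : R -> R).

Definition transfer (f : R -> R) (z : R) : R :=
  pu z * f (q * z + w) + pd z * f (q * z - w) + (1 - pu z - pd z) * f (q * z).

Local Notation b := (w / (1 - q)).

Local Notation lip_dom := (lip_ball b).
Local Notation osc_dom := (osc_ball b).

Hypotheses (q0 : 0 < q) (q1 : q < 1) (w0 : 0 < w).

Lemma radius_gt0 : 0 < b.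
Proof. by rewrite divr_gt0// subr_gt0. Qed.

(** The radius is the fixed point of [r |-> q * r + w], which is why the three moves preserve the
    ball. *)
Lemma radiusE : b = q * b + w.
Proof.
have : b * (1 - q) = w by rewrite divfK// subr_eq0 gt_eqF.
by move: b => B H; rewrite -[X in _ + X]H; ring.
Qed.

Lemma dom_moves (z : R) : `|z| <= b ->
  [/\ `|q * z + w| <= b, `|q * z - w| <= b & `|q * z| <= b].
Proof.
have w0' : 0 <= w := ltW w0.
have := radiusE; move: b => B BE; rewrite !ler_norml => /andP[z1 z2].
have qz1 : q * - B <= q * z by rewrite ler_wpM2l// ltW.
have qz2 : q * z <= q * B by rewrite ler_wpM2l// ltW.
rewrite mulrN in qz1.
move: (q * z) (q * B) BE qz1 qz2 => Z Q BE qz1 qz2; split; apply/andP; split; lra.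
Qed.

Lemma lip_osc L f : 0 <= L -> lip_dom L f -> osc_dom (L * (2 * b)) f.
Proof.
move=> L0 fL x y xb yb; apply: le_trans (fL x y xb yb) _.
rewrite ler_wpM2l//; apply: le_trans (ler_normB _ _) _.
by move: b xb yb => B xB yB; lra.
Qed.

Hypotheses (pu0 : forall z : R, 0 <= pu z) (pd0 : forall z : R, 0 <= pd z)
  (ps0 : forall z : R, 0 <= 1 - pu z - pd z).

Lemma transferD f g : transfer (f \+ g) = transfer f \+ transfer g.
Proof. by apply/funext => z; rewrite /transfer/=; ring. Qed.

Lemma transferZ a f : transfer (a \o* f) = a \o* transfer f.
Proof. by apply/funext => z; rewrite /transfer/=; ring. Qed.

Lemma transfer_cst a : transfer (cst a) = cst a.
Proof. by apply/funext => z; rewrite /transfer/=; ring. Qed.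

Lemma transfer_le f g : (forall z : R, `|z| <= b -> f z <= g z) ->
  forall z : R, `|z| <= b -> transfer f z <= transfer g z.
Proof.
move=> fg z zb; have [z1 z2 z3] := dom_moves zb.
by rewrite /transfer; apply: lerD; first apply: lerD;
  rewrite ler_wpM2l ?ps0//; apply: fg.
Qed.

(** A common band of values, with [m] the infimum of [f]: an average of total weight [1 - dl] over
    values in it lies in a band of width [(1 - dl) * M], wherever the chain starts. *)
Lemma osc_dom_range M f : osc_dom M f ->
  exists m, forall x : R, `|x| <= b -> m <= f x <= m + M.
Proof.
move=> oM; pose S := f @` [set x : R | `|x| <= b].
have b0 : `|0 : R| <= b by rewrite normr0 ltW// radius_gt0.
have Slb : has_lbound S.
  exists (f 0 - M) => _ [x /= xb <-].
  by have := oM _ _ xb b0; rewrite ler_norml => /andP[? _]; lra.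
have S0 : S !=set0 by exists (f 0), 0.
exists (inf S) => x xb; apply/andP; split.
  by apply: ge_inf => //; exists x.
rewrite -lerBlDr; apply: lb_le_inf => // _ [y /= yb <-].
by have := oM _ _ xb yb; rewrite ler_norml => /andP[_ ?]; lra.
Qed.

Variable dl : R.
Hypotheses (dl0 : 0 < dl) (dl1 : dl <= 1)
  (pu_dl : forall z : R, `|z| <= b -> dl <= pu z).

(* Doeblin coupling: both chains jump up together with probability dl. *)
Lemma transfer_doeblin M f : osc_dom M f -> forall x y : R, `|x| <= b -> `|y| <= b ->
  `|transfer f x - transfer f y| <=
    dl * `|f (q * x + w) - f (q * y + w)| + (1 - dl) * M.
Proof.
move=> oM x y xb yb; have [m mf] := osc_dom_range oM.
have rest (z : R) : `|z| <= b ->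
    (1 - dl) * m <= transfer f z - dl * f (q * z + w) <= (1 - dl) * (m + M).
  move=> zb; have [/mf/andP[u1 u2] /mf/andP[d1 d2] /mf/andP[s1 s2]] :=
    dom_moves zb.
  have := pu_dl zb; have := pd0 z; have := ps0 z; rewrite /transfer.
  move: (f (q * z + w)) (f (q * z - w)) (f (q * z)) (pu z) (pd z) u1 u2 d1 d2 s1 s2.
  by move=> fu fd fs PU PD *; apply/andP; split; nra.
have /andP[x1 x2] := rest x xb; have /andP[y1 y2] := rest y yb.
have -> : transfer f x - transfer f y =
   dl * (f (q * x + w) - f (q * y + w)) +
   ((transfer f x - dl * f (q * x + w)) - (transfer f y - dl * f (q * y + w))).
  by ring.
apply: le_trans (ler_normD _ _) _.
rewrite normrM (gtr0_norm dl0) lerD2l ler_norml; apply/andP; split; lra.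
Qed.

Lemma osc_transfer M f : osc_dom M f -> osc_dom M (transfer f).
Proof.
move=> oM x y xb yb; apply: le_trans (transfer_doeblin oM xb yb) _.
have [xu _ _] := dom_moves xb; have [yu _ _] := dom_moves yb.
have := ler_wpM2l (ltW dl0) (oM _ _ xu yu).
move: (`|f _ - _|) => a; rewrite mulrBl mul1r.
by move: (dl * M) (dl * a) => u v ?; lra.
Qed.

Variable kp : R.
Hypotheses (kp0 : 0 <= kp) (pu_lip : forall x y : R, `|pu x - pu y| <= kp * `|x - y|)
  (pd_lip : forall x y : R, `|pd x - pd y| <= kp * `|x - y|).

(** Frozen weights average differences over points [q * |x - y|] apart, which gives [q * L]. The
    weight of staying changes by minus the sum of the other two changes, so varying weights only
    multiply differences of values of [f], each at most [M]. *)
Lemma lip_transfer L M f : 0 <= L -> lip_dom L f -> osc_dom M f ->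
  lip_dom (q * L + 2 * kp * M) (transfer f).
Proof.
move=> L0 fL oM x y xb yb.
have [xu xd xs] := dom_moves xb; have [yu yd ys] := dom_moves yb.
have -> : transfer f x - transfer f y =
    (pu x * (f (q * x + w) - f (q * y + w))
     + pd x * (f (q * x - w) - f (q * y - w))
     + (1 - pu x - pd x) * (f (q * x) - f (q * y)))
    + ((pu x - pu y) * (f (q * y + w) - f (q * y))
     + (pd x - pd y) * (f (q * y - w) - f (q * y))).
  by rewrite /transfer; ring.
have qxy : `|q * x - q * y| = q * `|x - y| by rewrite -mulrBr normrM gtr0_norm.
have := fL _ _ xu yu; have := fL _ _ xd yd; have := fL _ _ xs ys.
have -> : q * x + w - (q * y + w) = q * x - q * y by ring.
have -> : q * x - w - (q * y - w) = q * x - q * y by ring.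
rewrite qxy => Hs Hd Hu.
have H1 := oM _ _ yu ys; have H2 := oM _ _ yd ys.
have M0 : 0 <= M by apply: le_trans H1.
rewrite [leRHS]mulrDl; apply: le_trans (ler_normD _ _) _; apply: lerD.
  apply: le_trans (ler_normD _ _) _.
  apply: le_trans (lerD (ler_normD _ _) (lexx _)) _.
  rewrite !normrM !(ger0_norm (pu0 _), ger0_norm (pd0 _), ger0_norm (ps0 _)).
  have := pu0 x; have := pd0 x; have := ps0 x.
  move: (`|f (_ + _) - _|) (`|f (_ - _) - _|) (`|f _ - f _|) Hs Hd Hu.
  move: (`|x - y|) (pu x) (pd x) => D U V A B C HA HB HC *.
  have -> : q * L * D = U * (L * (q * D)) + V * (L * (q * D))
    + (1 - U - V) * (L * (q * D)) by ring.
  by apply: lerD; first apply: lerD; apply: ler_wpM2l.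
apply: le_trans (ler_normD _ _) _; rewrite !normrM.
have -> : 2 * kp * M * `|x - y| = kp * `|x - y| * M + kp * `|x - y| * M by ring.
by apply: lerD; apply: ler_pM.
Qed.

(* The fixed point of [L |-> q * L + 2 * kp * (2 * b)], plus 1. *)
Let lipK := 1 + 4 * kp * b / (1 - q).

Let lipK_ge0 : 0 <= lipK.
Proof.
by rewrite addr_ge0// !(mulr_ge0, divr_ge0)// ltW// ?radius_gt0//
  ?invr_gt0 subr_gt0.
Qed.

Lemma osc_iter_transfer k M f : osc_dom M f -> osc_dom M (iter k transfer f).
Proof. by move=> oM; elim: k => //= k; exact: osc_transfer. Qed.

(** The oscillation never exceeds [L * (2 * b)], so the constants obey an affine recursion of slope
    [q < 1], and the level [lipK * L] is not crossed. The summand 1 in [lipK] covers the start of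
    the recursion. *)
Let lip_iter_transfer k L f : 0 <= L -> lip_dom L f ->
  lip_dom (lipK * L) (iter k transfer f).
Proof.
move=> L0 fL; have oM := lip_osc L0 fL.
elim: k => [|k IH] /=; move=> x y xb yb.
  apply: le_trans (fL x y xb yb) _; rewrite -[leLHS]mul1r -mulrA.
  rewrite ler_wpM2r ?mulr_ge0// lerDl.
  by rewrite !(mulr_ge0, divr_ge0)// ltW// ?radius_gt0// ?invr_gt0 subr_gt0.
have := lip_transfer (mulr_ge0 lipK_ge0 L0) IH (osc_iter_transfer k oM) xb yb.
move=> /le_trans; apply; rewrite ler_wpM2r//.
have q1' : 1 - q != 0 by rewrite subr_eq0 gt_eqF.
have -> : q * (lipK * L) + 2 * kp * (L * (2 * b)) =
    lipK * L - (1 - q) * L by rewrite /lipK; field.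
by rewrite gerBl mulr_ge0// subr_ge0 ltW.
Qed.

Let osc_iter_step n L M f : 0 <= L -> lip_dom L f -> osc_dom M f ->
  forall x y : R, `|x| <= b -> `|y| <= b ->
  `|iter n transfer f x - iter n transfer f y| <=
    (dl * q) ^+ n * L * `|x - y| + (1 - dl ^+ n) * M.
Proof.
move=> L0 fL oM; elim: n => [|n IH] x y xb yb.
  by rewrite !expr0 subrr mul0r addr0 mul1r; exact: fL.
rewrite !iterS; apply: le_trans (transfer_doeblin (osc_iter_transfer n oM) xb yb) _.
have [xu _ _] := dom_moves xb; have [yu _ _] := dom_moves yb.
have /(ler_wpM2l (ltW dl0)) := IH _ _ xu yu.
have -> : q * x + w - (q * y + w) = q * (x - y) by ring.
rewrite normrM (gtr0_norm q0) => H.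
rewrite -(lerD2r ((1 - dl) * M)) in H; apply: le_trans H _.
by rewrite !exprS le_eqVlt; apply/orP; left; apply/eqP; ring.
Qed.

(** One block of [n] steps sends an oscillation [M] to at most [(dl * q) ^+ n * lipK * L * (2 * b) +
    (1 - dl ^+ n) * M]. The first summand of the bound is the fixed point of this map; the second is
    the initial oscillation, damped geometrically. *)
Let osc_iter_geom n m L f : 0 <= L -> lip_dom L f ->
  osc_dom (L * (2 * b * lipK * q ^+ n + (1 - dl ^+ n) ^+ m * (2 * b)))
    (iter (m * n) transfer f).
Proof.
move=> L0 fL; elim: m => [|m IH] x y xb yb.
  rewrite mul0n expr0 mul1r; apply: le_trans (lip_osc L0 fL xb yb) _.
  rewrite ler_wpM2l// lerDr !mulr_ge0 ?exprn_ge0 ?lipK_ge0 ?(ltW q0)//.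
  by rewrite ltW.
  by rewrite invr_ge0 subr_ge0 ltW.
rewrite mulSn iterD.
apply: le_trans (osc_iter_step n (mulr_ge0 lipK_ge0 L0)
  (lip_iter_transfer _ L0 fL) IH xb yb) _.
have xy : `|x - y| <= 2 * b.
  by apply: le_trans (ler_normB _ _) _; move: b xb yb => B; lra.
have H : (dl * q) ^+ n * (lipK * L) * `|x - y|
    <= (dl * q) ^+ n * (lipK * L) * (2 * b).
  by rewrite ler_wpM2l// !mulr_ge0// exprn_ge0// mulr_ge0// ltW.
rewrite -(lerD2r ((1 - dl ^+ n) *
   (L * (2 * b * lipK * q ^+ n + (1 - dl ^+ n) ^+ m * (2 * b))))) in H.
apply: le_trans H _; rewrite exprMn exprS le_eqVlt; apply/orP; left.
by apply/eqP; ring.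
Qed.

Let small_expr (a C e : R) : 0 <= a < 1 -> 0 < e -> 0 <= C ->
  exists n, C * a ^+ n <= e.
Proof.
move=> /andP[a0 a1] e0 C0.
have : (fun n => C * a ^+ n) @ \oo --> (C * 0 : R).
  by apply: cvgMr; apply: cvg_expr; rewrite ger0_norm.
rewrite mulr0 => /cvgr0Pnorm_le /(_ _ e0) [n _ /(_ n (leqnn _))].
by rewrite ger0_norm ?mulr_ge0 ?exprn_ge0//; exists n.
Qed.

(* First [n] with [q ^ n] small, then [m] with [(1 - dl ^ n) ^ m] small. *)
Lemma transfer_mixing e : 0 < e -> exists k0, forall k f L, (k0 <= k)%N ->
  0 <= L -> lip_dom L f -> osc_dom (e * L) (iter k transfer f).
Proof.
move=> e0; have b0 := radius_gt0.
have e20 : 0 < e / 2 by rewrite divr_gt0.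
have [n Hn] : exists n, 2 * b * lipK * q ^+ n <= e / 2.
  apply: small_expr => //; first by rewrite (ltW q0).
  exact: mulr_ge0 (mulr_ge0 (ler0n _ 2) (ltW b0)) lipK_ge0.
have [m Hm] : exists m, 2 * b * (1 - dl ^+ n) ^+ m <= e / 2.
  apply: small_expr => //; last by rewrite mulr_ge0// ltW.
  by rewrite subr_ge0 exprn_ile1// ?(ltW dl0)// gtrBl exprn_gt0.
exists (m * n)%N => k f L kmn L0 fL.
rewrite -(subnK kmn) iterD; apply: osc_iter_transfer => x y xb yb.
apply: le_trans (osc_iter_geom n m L0 fL xb yb) _.
rewrite mulrC ler_wpM2r//; move: Hn Hm; set u := _ * q ^+ n; set v := _ ^+ m.
by move: b => B *; lra.
Qed.

Lemma iter_transfer_le k f g : (forall z : R, `|z| <= b -> f z <= g z) ->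
  forall z : R, `|z| <= b -> iter k transfer f z <= iter k transfer g z.
Proof. by move=> fg; elim: k => //= k IH; exact: transfer_le. Qed.

Lemma iter_transfer_eq k f g : (forall z : R, `|z| <= b -> f z = g z) ->
  forall z : R, `|z| <= b -> iter k transfer f z = iter k transfer g z.
Proof.
move=> fg z zb; apply/eqP; rewrite eq_le !iter_transfer_le// => y yb;
  by rewrite fg.
Qed.

Lemma iter_transfer_cst k a : iter k transfer (cst a) = cst a.
Proof. by elim: k => //= k ->; exact: transfer_cst. Qed.

Lemma iter_transferD k f g :
  iter k transfer (f \+ g) = iter k transfer f \+ iter k transfer g.
Proof. by elim: k => //= k ->; exact: transferD. Qed.

Lemma iter_transferZ k a f : iter k transfer (a \o* f) = a \o* iter k transfer f.
Proof. by elim: k => //= k ->; exact: transferZ. Qed.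

(** The starting point 0 is only a choice: [ergodic_mean_close] gives the same limit from every
    point of the ball, for Lipschitz [f]. *)
Definition ergodic_mean (f : R -> R) : R := limn (fun k => iter k transfer f 0).

Let zero_dom : `|0 : R| <= b.
Proof. by rewrite normr0 ltW// radius_gt0. Qed.

(** Further steps preserve order and constants, so they cannot leave the band of half-width [e]
    around one value of the [k]-th iterate. *)
Let iter_transfer_close e k f x : osc_dom e (iter k transfer f) -> `|x| <= b ->
  forall j, (k <= j)%N -> `|iter j transfer f 0 - iter k transfer f x| <= e.
Proof.
move=> fe xb j kj; rewrite -(subnK kj) iterD; set g := iter k _ f.
have gx z : `|z| <= b -> g x - e <= g z <= g x + e.
  by move=> zb; rewrite -ler_distl; exact: fe.
rewrite ler_distl; apply/andP; split.
  rewrite -[leLHS]/(cst (g x - e) (0 : R)) -(iter_transfer_cst (j - k)).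
  by apply: iter_transfer_le => // z /gx /andP[].
rewrite -[leRHS]/(cst (g x + e) (0 : R)) -(iter_transfer_cst (j - k)).
by apply: iter_transfer_le => // z /gx /andP[].
Qed.

Lemma is_cvg_iter_transfer L f : 0 <= L -> lip_dom L f ->
  cvgn (fun k => iter k transfer f 0).
Proof.
move=> L0 fL; apply/cauchy_cvgP/cauchy_exP => e e0.
(* Dividing by [L + 1] allows [L = 0]; the halving gives the strict inequality of an open ball. *)
have eL0 : 0 < e / 2 / (L + 1) by rewrite !divr_gt0// ltr_wpDl.
have [k0 Hk] := transfer_mixing eL0.
exists (iter k0 transfer f 0), k0 => // j /= kj.
rewrite /ball/= distrC.
have := iter_transfer_close (Hk _ _ _ (leqnn _) L0 fL) zero_dom kj.
move=> /le_lt_trans; apply.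
have -> : e / 2 / (L + 1) * L = e / 2 * (L / (L + 1)) by ring.
have : L / (L + 1) <= 1 by rewrite ler_pdivrMr ?mul1r ?lerDl ?ltr_wpDl.
have e20 : 0 < e / 2 by rewrite divr_gt0.
move/(ler_wpM2l (ltW e20)); rewrite mulr1 => /le_lt_trans; apply.
by move: e0 => ?; lra.
Qed.

(** Here [k0] is chosen before [f] and [x]: this uniformity is what convergence in Kantorovich
    distance, uniform in the starting point, consists of. *)
Lemma ergodic_mean_close e : 0 < e -> exists k0, forall k f L, (k0 <= k)%N ->
  0 <= L -> lip_dom L f ->
  forall x, `|x| <= b -> `|iter k transfer f x - ergodic_mean f| <= e * L.
Proof.
move=> /transfer_mixing[k0 Hk]; exists k0 => k f L kk0 L0 fL x xb.
have cf := is_cvg_iter_transfer L0 fL.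
have close := iter_transfer_close (Hk _ _ _ kk0 L0 fL) xb.
rewrite distrC ler_distl; apply/andP; split.
  apply: limr_ge => //; exists k => // j /= kj.
  by have := close _ kj; rewrite ler_distl => /andP[].
apply: limr_le => //; exists k => // j /= kj.
by have := close _ kj; rewrite ler_distl => /andP[].
Qed.

Lemma ergodic_mean_cst a : ergodic_mean (cst a) = a.
Proof.
rewrite /ergodic_mean; under eq_fun do rewrite iter_transfer_cst.
exact: lim_cst.
Qed.

Lemma ergodic_meanD L1 L2 f g : 0 <= L1 -> 0 <= L2 ->
  lip_dom L1 f -> lip_dom L2 g ->
  ergodic_mean (f \+ g) = ergodic_mean f + ergodic_mean g.
Proof.
move=> L10 L20 fL gL; rewrite /ergodic_mean.
under eq_fun do rewrite iter_transferD/=.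
rewrite limD//; first exact: is_cvg_iter_transfer L10 fL.
exact: is_cvg_iter_transfer L20 gL.
Qed.

Lemma ergodic_meanZ L a f : 0 <= L -> lip_dom L f ->
  ergodic_mean (a \o* f) = ergodic_mean f * a.
Proof.
move=> L0 fL; rewrite /ergodic_mean.
under eq_fun do rewrite iter_transferZ/=.
by apply/cvg_lim => //; apply: cvgMl; exact: is_cvg_iter_transfer L0 fL.
Qed.

Lemma ergodic_mean_le L1 L2 f g : 0 <= L1 -> 0 <= L2 ->
  lip_dom L1 f -> lip_dom L2 g -> (forall z : R, `|z| <= b -> f z <= g z) ->
  ergodic_mean f <= ergodic_mean g.
Proof.
move=> L10 L20 fL gL fg; apply: ler_lim.
- exact: is_cvg_iter_transfer L10 fL.
- exact: is_cvg_iter_transfer L20 gL.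
- by apply: nearW => k; exact: iter_transfer_le.
Qed.

End transfer.
(** * Positive functionals on Lipschitz functions and measures on an interval *)

Section lipb.
Context {R : realType} (r : R).

Definition lipb (f : R -> R) : Prop := exists2 L, 0 <= L & lip_ball r L f.

Lemma lipb_cst a : lipb (cst a).
Proof. by exists 0 => // x y _ _; rewrite subrr normr0 mul0r. Qed.

Lemma lipbD f g : lipb f -> lipb g -> lipb (f \+ g).
Proof.
move=> [L L0 fL] [M M0 gM]; exists (L + M); first exact: addr_ge0.
move=> x y xr yr /=.
have -> : f x + g x - (f y + g y) = (f x - f y) + (g x - g y) by ring.
apply: le_trans (ler_normD _ _) _; rewrite mulrDl.
by apply: lerD; [exact: fL|exact: gM].
Qed.

Lemma lipbZ a f : lipb f -> lipb (a \o* f).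
Proof.
move=> [L L0 fL]; exists (L * `|a|); first exact: mulr_ge0.
move=> x y xr yr /=; rewrite -mulrBl normrM mulrAC.
by rewrite ler_wpM2r//; exact: fL.
Qed.

(** Shared by the limit functional and by integration against a probability measure on the interval,
    so that the two can be compared. Additivity and order are asked on Lipschitz functions only,
    where the limit is known to exist. *)
Record posfun (Lam : (R -> R) -> R) : Prop := Posfun {
  posfun_cst : forall a, Lam (cst a) = a;
  posfunD : forall f g, lipb f -> lipb g -> Lam (f \+ g) = Lam f + Lam g;
  posfunZ : forall a f, lipb f -> Lam (a \o* f) = Lam f * a;
  posfun_le : forall f g, lipb f -> lipb g ->
    (forall x : R, `|x| <= r -> f x <= g x) -> Lam f <= Lam g }.

Lemma posfun_dist Lam f g e : posfun Lam -> lipb f -> lipb g ->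
  (forall x : R, `|x| <= r -> `|f x - g x| <= e) -> `|Lam f - Lam g| <= e.
Proof.
move=> pL lf lg fg; rewrite ler_distl; apply/andP; split.
  rewrite lerBlDr -[X in _ + X](posfun_cst pL) -posfunD//; last exact: lipb_cst.
  apply: posfun_le => //; first by apply: lipbD => //; exact: lipb_cst.
  by move=> x /fg /=; rewrite ler_distl lerBlDr => /andP[].
rewrite -[X in _ + X](posfun_cst pL) -posfunD//; last exact: lipb_cst.
apply: posfun_le => //; first by apply: lipbD => //; exact: lipb_cst.
by move=> x /fg /=; rewrite ler_distl => /andP[].
Qed.

End lipb.

Section ramp.
Context {R : realType}.
Implicit Types x y e : R.

(** For [0 < e], a Lipschitz function between the indicators of []-oo, y]] and []-oo, y + e]]; this
    sandwich links a functional to a distribution function. *)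
Definition ramp y e x : R := Num.max 0 (Num.min 1 ((y + e - x) / e)).

Lemma ramp_ge0 y e x : 0 <= ramp y e x.
Proof. by rewrite /ramp le_max lexx. Qed.

Lemma ramp_le1 y e x : ramp y e x <= 1.
Proof. by rewrite /ramp ge_max ler01 ge_min lexx. Qed.

Lemma ramp1 y e x : 0 < e -> x <= y -> ramp y e x = 1.
Proof.
move=> e0 xy; apply/eqP; rewrite eq_le ramp_le1/= /ramp le_max le_min lexx/=.
by rewrite ler_pdivlMr// mul1r; apply/orP; right; lra.
Qed.

Lemma ramp0 y e x : 0 < e -> y + e <= x -> ramp y e x = 0.
Proof.
move=> e0 xy; apply/eqP; rewrite eq_le ramp_ge0 andbT /ramp ge_max lexx/=.
by rewrite ge_min ler_pdivrMr// mul0r subr_le0 xy orbT.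
Qed.

Lemma ramp_le y e y' e' x : 0 < e -> 0 < e' -> y + e <= y' ->
  ramp y e x <= ramp y' e' x.
Proof.
move=> e0 e'0 yy'; have [xy|yx] := leP x y'.
  by rewrite (ramp1 e'0 xy) ramp_le1.
by rewrite (ramp0 e0) ?ramp_ge0//; lra.
Qed.

(** Clamping to [[0, 1]] is monotone and does not enlarge gaps; [k = 0] is the monotone case. *)
Lemma max_min_dist (a c k : R) : a <= c + k -> 0 <= k ->
  Num.max 0 (Num.min 1 a) <= Num.max 0 (Num.min 1 c) + k.
Proof.
move=> ack k0; rewrite ge_max; apply/andP; split.
  by rewrite addr_ge0// le_max lexx.
have [c1|c1] := leP 1 c.
  apply: (@le_trans _ _ 1); first by rewrite ge_min lexx.
  by rewrite -[leLHS]addr0 lerD// le_max lexx orbT.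
rewrite ge_min; apply/orP; right; apply: le_trans ack _.
by rewrite lerD2r le_max lexx orbT.
Qed.

(** At fixed width the cost of a shift is linear in it; right continuity of the distribution
    function rests on this. *)
Lemma ramp_shift y y' e x : 0 < e -> y <= y' ->
  ramp y' e x <= ramp y e x + (y' - y) / e.
Proof.
move=> e0 yy'; apply: max_min_dist; last by rewrite divr_ge0 ?subr_ge0// ltW.
by rewrite -mulrDl le_eqVlt; apply/orP; left; apply/eqP; congr (_ / _); ring.
Qed.

Lemma ramp_homo y y' e x : 0 < e -> y <= y' -> ramp y e x <= ramp y' e x.
Proof.
move=> e0 yy'; rewrite -[leRHS]addr0; apply: max_min_dist => //.
by rewrite addr0 ler_pM2r ?invr_gt0//; lra.
Qed.

Lemma lip_ramp r y e : 0 < e -> lip_ball r e^-1 (ramp y e).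
Proof.
move=> e0.
have H x x' : ramp y e x <= ramp y e x' + e^-1 * `|x - x'|.
  apply: max_min_dist; last by rewrite mulr_ge0// invr_ge0 ltW.
  rewrite [e^-1 * _]mulrC -mulrDl ler_pM2r ?invr_gt0//.
  by have := ler_norm (x' - x); rewrite distrC => ?; lra.
move=> x x' _ _; rewrite ler_distl; apply/andP; split; last exact: H.
by rewrite lerBlDr distrC; exact: H.
Qed.

Lemma lipb_ramp r y e : 0 < e -> lipb r (ramp y e).
Proof. by move=> e0; exists e^-1; [rewrite invr_ge0 ltW|exact: lip_ramp]. Qed.

End ramp.

(** * Comparison of two positive functionals by piecewise linear interpolation *)

Section interpolation.
Context {R : realType} (r : R) (r0 : 0 < r) (Lam I : (R -> R) -> R)
  (pL : posfun r Lam) (pI : posfun r I) (F : R -> R).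
Hypotheses (F01 : forall x : R, 0 <= F x <= 1)
  (LF : forall y e : R, 0 < e -> F y <= Lam (ramp y e) <= F (y + e))
  (IF : forall y e : R, 0 < e -> F y <= I (ramp y e) <= F (y + e)).

Variables (f : R -> R) (L : R) (n : nat).
Hypotheses (L0 : 0 <= L) (fL : lip_ball r L f) (n0 : (0 < n)%N).

Let dt := 2 * r / n%:R.
Let node m := - r + m%:R * dt.

Let dt0 : 0 < dt.
Proof. by rewrite divr_gt0 ?mulr_gt0 ?ltr0n. Qed.

Let nodeS m : node m.+1 = node m + dt.
Proof. by rewrite /node -natr1; ring. Qed.

Let node_n : node n = r.
Proof. by rewrite /node mulrC divfK ?pnatr_eq0 -?lt0n//; ring. Qed.

Let node_dom m : (m <= n)%N -> `|node m| <= r.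
Proof.
move=> mn; rewrite ler_norml; apply/andP; split.
  by rewrite lerDl mulr_ge0// ltW.
by rewrite -[leRHS]node_n lerD2l ler_wpM2r ?ler_nat// ltW.
Qed.

(** A starting constant plus increments times [1 - ramp], rather than a sum of hat functions: each
    new cell then involves the value of a functional on a single ramp. *)
Fixpoint interp m : R -> R :=
  if m is k.+1 then
    interp k \+ (f (node k.+1) - f (node k)) \o*
                (cst 1 \+ (-1) \o* ramp (node k) dt)
  else cst (f (node 0)).

Let rise y := cst 1 \+ (-1) \o* ramp y dt.

Let lipb_rise y : lipb r (rise y).
Proof.
by apply: lipbD; [exact: lipb_cst|apply: lipbZ; exact: lipb_ramp].
Qed.

Let lipb_interp m : lipb r (interp m).
Proof.
elim: m => [|m IH] /=; first exact: lipb_cst.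
by apply: lipbD => //; apply: lipbZ; exact: lipb_rise.
Qed.

Let interp_right m x : node m <= x -> interp m x = f (node m).
Proof.
elim: m => [//|m IH] mx /=; rewrite nodeS in mx.
by rewrite IH ?ramp0//; [ring|have := dt0; move=> ?; lra].
Qed.

Let df m : (m < n)%N -> `|f (node m.+1) - f (node m)| <= L * dt.
Proof.
move=> mn; apply: le_trans (fL (node_dom mn) (node_dom (ltnW mn))) _.
by rewrite nodeS addrAC subrr add0r gtr0_norm.
Qed.

Let interp_close m x : (m <= n)%N -> `|x| <= r -> x <= node m ->
  `|f x - interp m x| <= 2 * (L * dt).
Proof.
move=> + xr; elim: m => [_|m IH mn].
  rewrite /node mul0r addr0 /= => xr'.
  have -> : x = - r.
    by apply/eqP; rewrite eq_le xr'; move: xr; rewrite ler_norml => /andP[].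
  by rewrite /node mul0r addr0 subrr normr0 !mulr_ge0// ltW.
rewrite nodeS => xm /=; have [xm'|xm'] := leP x (node m).
  by rewrite ramp1// mul1r subrr mul0r addr0; apply: IH => //; exact: ltnW.
(* In the last cell [interp m] is already constant, equal to [f (node m)]. The variation of [f] and
   the partial rise cost [L * dt] each. *)
rewrite interp_right; last exact: ltW.
rewrite opprD addrA; apply: le_trans (ler_normB _ _) _.
have -> : 2 * (L * dt) = L * dt + L * dt by ring.
apply: lerD.
  apply: le_trans (fL xr (node_dom (ltnW mn))) _.
  by rewrite ler_wpM2l// gtr0_norm ?subr_gt0//; lra.
rewrite normrM -[leRHS]mul1r; apply: ler_pM => //; last exact: df.
have := ramp_ge0 (node m) dt x; have := ramp_le1 (node m) dt x.
by move=> ? ?; rewrite ler_norml; apply/andP; split; lra.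
Qed.

Let posfun_rise Phi y : posfun r Phi -> Phi (rise y) = 1 - Phi (ramp y dt).
Proof.
move=> pP; rewrite /rise (posfunD pP); first last.
- by apply: lipbZ; exact: lipb_ramp.
- exact: lipb_cst.
- by rewrite (posfun_cst pP) (posfunZ pP) ?mulrN1//; exact: lipb_ramp.
Qed.

(* Each ramp contributes at most [L * dt] times an increment of [F], and these
   increments telescope. *)
Let interp_dist m : (m <= n)%N ->
  `|Lam (interp m) - I (interp m)| <= L * dt * (F (node m) - F (node 0)).
Proof.
elim: m => [_|m IH mn] /=.
  by rewrite (posfun_cst pL) (posfun_cst pI) !subrr mulr0 normr0.
have lR : lipb r ((f (node m.+1) - f (node m)) \o* rise (node m)).
  by apply: lipbZ; exact: lipb_rise.
rewrite -/(rise (node m)) (posfunD pL)// (posfunD pI)//.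
rewrite (posfunZ pL _ (lipb_rise _)) (posfunZ pI _ (lipb_rise _)).
rewrite !posfun_rise//.
set A := Lam (interp m); set B := I (interp m); set k := f _ - f _.
set u := Lam _; set v := I _.
have -> : A + (1 - u) * k - (B + (1 - v) * k) = (A - B) + k * (v - u) by ring.
apply: le_trans (ler_normD _ _) _.
have -> : L * dt * (F (node m.+1) - F (node 0)) =
  L * dt * (F (node m) - F (node 0)) + L * dt * (F (node m.+1) - F (node m)).
  by ring.
apply: lerD; first exact: IH (ltnW mn).
rewrite normrM; apply: ler_pM => //; first exact: df.
have := LF (node m) dt0; have := IF (node m) dt0; rewrite -nodeS -/u -/v.
by move=> /andP[? ?] /andP[? ?]; rewrite ler_norml; apply/andP; split; lra.
Qed.

(** The factor is 5 = 2 + 2 + 1: replacing [f] by its interpolant costs [2 * (L * dt)] under each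
    functional, and the telescoped increments of [F] add up to at most 1. Atoms are harmless, since
    only this total enters. *)
Lemma posfun_interp_dist : `|Lam f - I f| <= 5 * (L * (2 * r)) / n%:R.
Proof.
have lf : lipb r f by exists L.
have close x : `|x| <= r -> `|f x - interp n x| <= 2 * (L * dt).
  move=> xr; apply: interp_close => //; rewrite node_n.
  by move: xr; rewrite ler_norml => /andP[].
have H1 := posfun_dist pL lf (lipb_interp n) close.
have H2 := posfun_dist pI lf (lipb_interp n) close.
have H3 := interp_dist (leqnn n).
have H4 : L * dt * (F (node n) - F (node 0)) <= L * dt.
  rewrite ler_piMr//; first by rewrite mulr_ge0// ltW.
  by have := F01 (node n); have := F01 (node 0) => /andP[? ?] /andP[? ?]; lra.
have -> : 5 * (L * (2 * r)) / n%:R = 5 * (L * dt) by rewrite /dt; ring.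
have := le_trans H3 H4; move: H1 H2; rewrite !ler_norml.
move=> /andP[? ?] /andP[? ?] /andP[? ?]; apply/andP; split; lra.
Qed.

End interpolation.

Lemma posfun_unique {R : realType} (r : R) (Lam I : (R -> R) -> R) (F : R -> R) :
  0 < r -> posfun r Lam -> posfun r I -> (forall x : R, 0 <= F x <= 1) ->
  (forall y e : R, 0 < e -> F y <= Lam (ramp y e) <= F (y + e)) ->
  (forall y e : R, 0 < e -> F y <= I (ramp y e) <= F (y + e)) ->
  forall f, lipb r f -> Lam f = I f.
Proof.
move=> r0 pL pI F01 LF IF f [L L0 fL].
apply/eqP; rewrite -subr_eq0 -normr_le0.
have H n : `|Lam f - I f| <= 5 * (L * (2 * r)) * n.+1%:R^-1.
  exact: (posfun_interp_dist r0 pL pI F01 LF IF L0 fL).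
suff : (fun n => 5 * (L * (2 * r)) * n.+1%:R^-1) @ \oo --> (5 * (L * (2 * r)) * 0 : R).
  rewrite mulr0 => cv; rewrite -(cvg_lim _ cv)//; apply: limr_ge; first exact: cvgP cv.
  exact: nearW.
by apply: cvgMr; exact: cvg_harmonic.
Qed.

(** * Integrals of Lipschitz functions and distribution functions on the interval *)

Section lipb_integral.
Context {R : realType} (r : R) (r0 : 0 < r).

Local Notation D := `[- r, r]%classic.

Lemma domP (x : R) : D x <-> `|x| <= r.
Proof. by rewrite /= in_itv/= ler_norml. Qed.

Lemma lipb_measurable f : lipb r f -> measurable_fun D f.
Proof.
move=> [L L0 fL]; apply: subspace_continuous_measurable_fun => //.
apply/subspace_continuousP => x /domP xr.
apply/cvgrPdist_le => e e0; near=> y.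
have yr : `|y| <= r.
  by apply/domP; near: y; exact: withinT.
apply: le_trans (fL _ _ xr yr) _.
have : `|x - y| <= e / (L + 1).
  near: y; apply: cvg_within.
  have eL0 : 0 < e / (L + 1) by rewrite divr_gt0// ltr_wpDl.
  by apply: filterS (nbhsx_ballx x _ eL0) => y; exact: ltW.
move/(ler_wpM2l L0)/le_trans; apply.
by rewrite mulrCA ler_piMr ?(ltW e0)// ler_pdivrMr ?mul1r ?lerDl ?ltr_wpDl.
Unshelve. all: by end_near. Qed.

Lemma lipb_bound f : lipb r f -> exists M, forall x : R, `|x| <= r -> `|f x| <= M.
Proof.
case=> L L0 fL; exists (`|f 0| + L * r) => x xr.
have -> : f x = f 0 + (f x - f 0) by ring.
apply: le_trans (ler_normD _ _) _; rewrite lerD2l.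
have z0 : `|0 : R| <= r by rewrite normr0 ltW.
apply: le_trans (fL _ _ xr z0) _.
by rewrite subr0 ler_wpM2l.
Qed.

Lemma lipb_integrable (m : {measure set R -> \bar R}) f : (m D < +oo)%E ->
  lipb r f -> m.-integrable D (EFin \o f).
Proof.
move=> mD lf; apply: measurable_bounded_integrable => //.
  exact: lipb_measurable.
have [M fM] := lipb_bound lf; exists M; split; first exact: num_real.
by move=> K MK x /domP xr /=; apply: le_trans (ltW MK); exact: fM.
Qed.

End lipb_integral.

Section integral_posfun.
Context {R : realType} (r : R) (r0 : 0 < r) (mu : probability R R).

Local Notation D := `[- r, r]%classic.
Local Notation m := (@Measure.sort _ R R mu).
Hypothesis muD : m D = 1%E.

Definition intf (f : R -> R) : R := \int[mu]_(x in D) f x.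

Let lipb_integrable f : lipb r f -> mu.-integrable D (EFin \o f).
Proof. by apply: lipb_integrable; rewrite ?muD ?ltry. Qed.

Lemma intfE f : lipb r f -> (\int[mu]_(x in D) (f x)%:E)%E = (intf f)%:E.
Proof. by move=> /lipb_integrable lf; rewrite fineK//; exact: integrable_fin_num. Qed.

Lemma posfun_intf : posfun r intf.
Proof.
split.
- by move=> a; rewrite /intf Rintegral_cst// muD mulr1.
- by move=> f g lf lg; rewrite /intf RintegralD//; exact: lipb_integrable.
- by move=> a f lf; rewrite /intf RintegralZr//; exact: lipb_integrable.
move=> f g lf lg fg; apply: le_Rintegral => //; [exact: lipb_integrable..|].
by move=> x /domP /fg.
Qed.

Lemma probI1 A : measurable A -> m (A `&` D) = m A.
Proof.
move=> mA; apply/eqP; rewrite eq_le; apply/andP; split.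
  by apply: le_measure; rewrite ?inE//; exact: measurableI.
have mD : measurable D by [].
have D0 : m (~` D) = 0%E.
  by have -> : m (~` D) = (1 - m D)%E := probability_setC mu mD; rewrite muD subee.
have : (m A <= m ((A `&` D) `|` ~` D))%E.
  apply: le_measure; rewrite ?inE//.
    by apply: measurableU; [exact: measurableI|exact: measurableC].
  by move=> x Ax; have [Dx|Dx] := pselect (D x); [left|right].
move=> /le_trans; apply.
apply: le_trans (measureU2 _ _ _) _ => //; first exact: measurableI.
  exact: measurableC.
by rewrite /= D0 adde0.
Qed.

Definition cdfr (y : R) : R := fine (m `]-oo, y]%classic).

Lemma intf_ramp y e : 0 < e -> cdfr y <= intf (ramp y e) <= cdfr (y + e).
Proof.
move=> e0; have lr := lipb_ramp r y e0; have ir := lipb_integrable lr.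
have ind z : (\int[mu]_(x in D) (\1_(`]-oo, z]%classic) x)%:E)%E = (cdfr z)%:E.
  by rewrite integral_indic// probI1// fineK// fin_num_measure.
rewrite -!lee_fin -intfE// -!ind; apply/andP; split.
  apply: ge0_le_integral => //.
  - by apply/measurable_EFinP; exact: measurable_indic.
  - by apply/measurable_EFinP; exact: lipb_measurable.
  move=> x _; rewrite lee_fin indicE; have [xy|xy] := leP x y.
    by rewrite ramp1// mem_set//= in_itv.
  by rewrite memNset ?ramp_ge0//= in_itv/=; apply/negP; rewrite -ltNge.
apply: ge0_le_integral => //.
- by move=> x _; rewrite lee_fin ramp_ge0.
- by apply/measurable_EFinP; exact: lipb_measurable.
- by apply/measurable_EFinP; exact: measurable_indic.
move=> x _; rewrite lee_fin indicE; have [xy|xy] := leP x (y + e).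
  by rewrite mem_set ?ramp_le1//= in_itv.
by rewrite ramp0 ?ler0n// ltW.
Qed.

End integral_posfun.

Lemma itvNy_bigcup {R : realType} (y : R) :
  `]-oo, y[%classic = \bigcup_n `]-oo, y - n.+1%:R^-1]%classic.
Proof.
apply/seteqP; split => [x|x [n _]] /=; rewrite !in_itv/=; last first.
  by move=> /le_lt_trans; apply; rewrite gtrDl oppr_lt0 invr_gt0.
move=> xy; have xy' : 0 < y - x by rewrite subr_gt0.
have [n] := ltr_add_invr xy'; rewrite add0r => nx.
by exists n => //=; rewrite in_itv/= lerBrDr addrC -lerBrDr ltW.
Qed.

Section prob_unique.
Context {R : realType} (r : R) (r0 : 0 < r).

Local Notation D := `[- r, r]%classic.
Local Notation m mu := (@Measure.sort _ R R mu).

(** Open rays are the generators used in [prob_unique]. A closed ray ending at [x < y] lies below a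
    ramp that vanishes before [y], so its [mu]-mass is at most the [nu]-mass of the open ray; then
    [x] increases to [y]. Exchanging the measures gives equality. *)
Let prob_le_itv (mu nu : probability R R) : m mu D = 1%E -> m nu D = 1%E ->
  (forall y e, 0 < e -> intf r mu (ramp y e) = intf r nu (ramp y e)) ->
  forall y, (m mu `]-oo, y[%classic <= m nu `]-oo, y[%classic)%E.
Proof.
move=> muD nuD mn y; rewrite [X in (m mu X <= _)%E]itvNy_bigcup.
have : m mu `]-oo, y - n.+1%:R^-1]%classic @[n --> \oo] -->
    m mu (\bigcup_n `]-oo, y - n.+1%:R^-1]%classic).
  apply: nondecreasing_cvg_mu => //; first exact: bigcup_measurable.
  move=> i j ij; apply/subsetPset => x /=; rewrite !in_itv/= => /le_trans; apply.
  by rewrite lerD2l lerN2 lef_pV2 ?posrE// ler_nat.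
move=> /cvg_lim <- //; apply: lime_le.
  apply: ereal_nondecreasing_is_cvgn => i j ij; apply: le_measure; rewrite ?inE//.
  move=> x /=; rewrite !in_itv/= => /le_trans; apply.
  by rewrite lerD2l lerN2 lef_pV2 ?posrE// ler_nat.
apply: nearW => n.
(* Half the gap between [x] and [y], so that the ramp ends strictly before [y]. *)
have e0 : 0 < n.+1%:R^-1 / 2 :> R by rewrite divr_gt0// invr_gt0.
set x := y - n.+1%:R^-1.
have /andP[+ _] := intf_ramp r0 muD x e0; rewrite mn// => H1.
have /andP[_ H2] := intf_ramp r0 nuD x e0.
have := le_trans H1 H2; rewrite -lee_fin !fineK ?fin_num_measure// => /le_trans.
apply; apply: le_measure; rewrite ?inE// => z /=; rewrite !in_itv/=.
move/le_lt_trans; apply; rewrite /x -addrA gtrDl.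
by move: (n.+1%:R^-1) e0 => e *; lra.
Qed.

Lemma prob_unique (mu nu : probability R R) : m mu D = 1%E -> m nu D = 1%E ->
  (forall y e, 0 < e -> intf r mu (ramp y e) = intf r nu (ramp y e)) ->
  forall A, measurable A -> m mu A = m nu A.
Proof.
move=> muD nuD mn A mA.
refine (@measure_unique _ R R (@RGenInftyO.G R) (fun k => `]-oo, k%:R[%classic)
  _ _ _ _ mu nu _ _ A mA).
- exact: RGenInftyO.measurableE.
- move=> _ _ [x ->] [y ->]; exists (Num.min x y); apply/seteqP; split => z /=.
    by rewrite !in_itv/= lt_min => -[-> ->].
  by rewrite !in_itv/= lt_min => /andP[].
- by move=> k; exists k%:R.
- apply/seteqP; split => // x _.
  exists (Num.bound `|x|) => //=; rewrite in_itv/=.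
  by apply: le_lt_trans (ler_norm _) _; exact: archi_boundP.
- move=> _ [y ->]; apply/eqP; rewrite eq_le !prob_le_itv//.
  by move=> y' e e0; rewrite mn.
- by move=> k; exact: le_lt_trans (probability_le1 mu (measurable_itv _)) (ltry _).
Qed.

End prob_unique.

Section riesz.
Context {R : realType} (r : R) (r0 : 0 < r) (Lam : (R -> R) -> R)
  (pL : posfun r Lam).

Local Notation D := `[- r, r]%classic.

Let ramps (y : R) : set R := [set Lam (ramp y e) | e in [set e | 0 < e]].
(** As [e] decreases to 0 the ramps decrease to the indicator of []-oo, y]], so this is the only
    candidate for the mass of that ray. *)
Let F y := inf (ramps y).

Let Lam_ramp01 y e : 0 < e -> 0 <= Lam (ramp y e) <= 1.
Proof.
move=> e0; have lr := lipb_ramp r y e0; apply/andP; split.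
  rewrite -[leLHS](posfun_cst pL); apply: (posfun_le pL) => //.
    exact: lipb_cst.
  by move=> x _; exact: ramp_ge0.
rewrite -[leRHS](posfun_cst pL); apply: (posfun_le pL) => //.
  exact: lipb_cst.
by move=> x _; exact: ramp_le1.
Qed.

Let ramps_inf y : has_inf (ramps y).
Proof.
split; first by exists (Lam (ramp y 1)); exists 1 => //=; exact: ltr01.
by exists 0 => _ [e /= e0 <-]; have /andP[] := Lam_ramp01 y e0.
Qed.

Let F_le y e : 0 < e -> F y <= Lam (ramp y e).
Proof. by move=> e0; apply: ge_inf; [exact: (ramps_inf y).2|exists e]. Qed.

Let F_ge y z : (forall e, 0 < e -> z <= Lam (ramp y e)) -> z <= F y.
Proof.
move=> H; apply: lb_le_inf; first exact: (ramps_inf y).1.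
by move=> _ [e /= e0 <-]; exact: H.
Qed.

Let F01 y : 0 <= F y <= 1.
Proof.
apply/andP; split; last first.
  by apply: le_trans (F_le y ltr01) _; have /andP[] := Lam_ramp01 y (@ltr01 R).
by apply: F_ge => e e0; have /andP[] := Lam_ramp01 y e0.
Qed.

Let LF y e : 0 < e -> F y <= Lam (ramp y e) <= F (y + e).
Proof.
move=> e0; rewrite F_le//=; apply: F_ge => e' e'0.
apply: (posfun_le pL); [exact: lipb_ramp..|] => x _.
exact: ramp_le.
Qed.

Let F_nd : {homo F : x y / x <= y}.
Proof.
move=> x y xy; apply: F_ge => e e0; apply: le_trans (F_le x e0) _.
apply: (posfun_le pL); [exact: lipb_ramp..|] => z _.
exact: ramp_homo.
Qed.

(** The ramp of width [- r - y] vanishes on the whole ball. At [y = - r] itself [F] may be positive: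
    an atom can sit there. *)
Let F_lo y : y < - r -> F y = 0.
Proof.
move=> yr; have e0 : 0 < - r - y by rewrite subr_gt0.
apply/eqP; rewrite eq_le (andP (F01 y)).1 andbT.
apply: le_trans (F_le y e0) _; rewrite -[leRHS](posfun_cst pL).
apply: (posfun_le pL); [exact: lipb_ramp|exact: lipb_cst|].
move=> x; rewrite ler_norml => /andP[xr _].
by rewrite ramp0//= addrC subrK.
Qed.

Let F_hi y : r <= y -> F y = 1.
Proof.
move=> yr; apply/eqP; rewrite eq_le (andP (F01 y)).2/=.
apply: F_ge => e e0; rewrite -[leLHS](posfun_cst pL).
apply: (posfun_le pL); [exact: lipb_cst|exact: lipb_ramp|].
move=> x; rewrite ler_norml => /andP[_ xr].
by rewrite ramp1//=; exact: le_trans yr.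
Qed.

(** A width [d] that is nearly optimal at [y] is kept for the nearby [z > y], and [ramp_shift] pays
    for the move. *)
Let F_rc : right_continuous F.
Proof.
move=> y; apply/cvgrPdist_le => e e0.
have e20 : 0 < e / 2 by rewrite divr_gt0.
have [_ [d /= d0 <-] Hd] := inf_adherent e20 (ramps_inf y).
near=> z.
have yz : y <= z by apply: ltW; near: z; exact: nbhs_right_gt.
have zy : (z - y) / d <= e / 2.
  rewrite ler_pdivrMr// lerBlDl; near: z; apply: nbhs_right_le.
  by rewrite ltrDl mulr_gt0.
rewrite distrC ger0_norm ?subr_ge0; last exact: F_nd.
have : Lam (ramp z d) <= Lam (ramp y d) + (z - y) / d.
  rewrite -[X in _ + X](posfun_cst pL) -(posfunD pL); first last.
  - exact: lipb_cst.
  - exact: lipb_ramp.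
  apply: (posfun_le pL); first exact: lipb_ramp.
    by apply: lipbD; [exact: lipb_ramp|exact: lipb_cst].
  by move=> x _; exact: ramp_shift.
have := F_le z d0; rewrite -/(F y) in Hd.
by move: e0 zy Hd => *; lra.
Unshelve. all: by end_near. Qed.

Let F_Ny0 : F @ -oo --> (0 : R).
Proof.
apply: (@cvg_trans _ (cst 0 @ -oo)); last exact: cvg_cst.
apply: near_eq_cvg; apply: filterS (nbhs_ninfty_lt (num_real (- r))) => y ry.
by rewrite F_lo.
Qed.

Let F_y1 : F @ +oo --> (1 : R).
Proof.
apply: (@cvg_trans _ (cst 1 @ +oo)); last exact: cvg_cst.
apply: near_eq_cvg; apply: filterS (nbhs_pinfty_ge (num_real r)) => y ry.
by rewrite F_hi.
Qed.

Lemma posfun_measure : exists2 mu : probability R R, @Measure.sort _ R R mu D = 1%E &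
  forall f, lipb r f -> intf r mu f = Lam f.
Proof.
pose F1 := isCumulative.Build R _ R F F_nd F_rc.
pose F2 := isCumulativeBounded.Build R 0 1 F F_Ny0 F_y1.
pose G : cumulativeBounded (0 : R) (1 : R) := HB.pack F F1 F2.
have [mu muE] : exists mu : probability R R,
    forall y, @Measure.sort _ R R mu `]-oo, y]%classic = (F y)%:E.
  by eexists => y; exact: (cdf_lebesgue_stieltjes_id G y).
(* Because of the possible atom at [- r], it is the open ray that must be null; it is a countable
   union of closed rays on which [F] is 0. *)
have lo0 : @Measure.sort _ R R mu `]-oo, - r[%classic = 0%E.
  rewrite itvNy_bigcup.
  apply: measure_negligible => //; first exact: bigcup_measurable.
  apply: negligible_bigcup => n; apply/negligibleP => //.
  by rewrite /= muE F_lo// gtrDl oppr_lt0 invr_gt0.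
have muD : @Measure.sort _ R R mu D = 1%E.
  have -> : D = `]-oo, r] `\` `]-oo, - r[.
    apply/seteqP; split => x /=; rewrite !in_itv/=.
      by move=> /andP[x1 x2]; split => //; apply/negP; rewrite -leNgt.
    by move=> [x2 /negP]; rewrite -leNgt x2 andbT.
  rewrite measureD//=; last by rewrite muE ltry.
  rewrite muE F_hi// setIidr ?lo0 ?sube0// => x /=; rewrite !in_itv/=.
  by move=> /ltW/le_trans; apply; rewrite ge0_cp// ltW.
exists mu => // f lf.
have cF y : cdfr mu y = F y by rewrite /cdfr muE.
apply: (posfun_unique r0 (posfun_intf r0 muD) pL F01) => // y e e0.
by rewrite -!cF; exact: intf_ramp.
Qed.

End riesz.
(** * Gaussian tails *)

Section erfc_facts.
Context {R : realType}.
Implicit Types x y : R.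
Local Notation leb := (@lebesgue_measure R).
Local Notation gauss := (fun t : R => expR (- t ^+ 2)).

Let integrable_gauss (A : set R) : measurable A ->
  leb.-integrable A (EFin \o gauss).
Proof.
by move=> mA; apply: (@integrableS _ _ _ _ setT) => //; exact: integrableT_gauss.
Qed.

Let fine_leb_itv x y : x <= y -> fine (leb `[x, y[%classic) = y - x.
Proof.
rewrite le_eqVlt => /predU1P[->|xy].
  by rewrite set_itvco0 measure0 subrr.
by rewrite lebesgue_measure_itv/= lte_fin xy.
Qed.

Let leb_itv_lty x y : (leb `[x, y[%classic < +oo)%E.
Proof. by rewrite lebesgue_measure_itv/=; case: ifP; rewrite ?ltry// -EFinB ltry. Qed.

Lemma erfcB x y : x <= y ->
  erfc x - erfc y = 2 / Num.sqrt pi * \int[leb]_(t in `[x, y[) expR (- t ^+ 2).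
Proof.
move=> xy; rewrite /erfc -mulrBr; congr (_ * _).
have -> : `[x, +oo[%classic = `[x, y[ `|` `[y, +oo[.
  by rewrite -itv_bndbnd_setU// bnd_simp.
rewrite Rintegral_setU//; [by rewrite addrK| |].
  by apply: integrable_gauss; exact: measurableU.
apply/disj_setPS => t [/=]; rewrite !in_itv/= => /andP[_ ty] /andP[+ _].
by rewrite leNgt ty.
Qed.

Let two_sqrtpi_gt0 : 0 < 2 / Num.sqrt pi :> R.
Proof. by rewrite divr_gt0// sqrtr_gt0 pi_gt0. Qed.

(** The Gaussian integrand is at most 1, so the normalising factor is a Lipschitz constant. *)
Lemma erfc_lip x y : `|erfc x - erfc y| <= 2 / Num.sqrt pi * `|x - y|.
Proof.
wlog xy : x y / x <= y => [H|].
  by have [/H//|/ltW/H] := leP x y; rewrite distrC [in leRHS]distrC.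
rewrite [leRHS](_ : _ = 2 / Num.sqrt pi * (y - x)); last first.
  by rewrite distrC ger0_norm// subr_ge0.
rewrite ger0_norm ?subr_ge0 ?erfc_nonincreasing// erfcB//.
rewrite ler_pM2l// -fine_leb_itv// -[leRHS]mul1r -Rintegral_cst//.
apply: le_Rintegral => //; first exact: integrable_gauss.
  apply: measurable_bounded_integrable => //.
    exact: leb_itv_lty.
  by exists 1; split => [|M /= M1 t _]; [exact: num_real|rewrite normr1 ltW].
by move=> t _; rewrite -expR0 ler_expR oppr_le0 sqr_ge0.
Qed.

Lemma erfc_gt0 x : 0 < erfc x.
Proof.
have x1 : x <= x + 1 by rewrite lerDl.
suff : 0 < erfc x - erfc (x + 1).
  by rewrite subr_gt0; apply: le_lt_trans; exact: erfc_ge0.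
rewrite erfcB// mulr_gt0//.
(* On [[x, x + 1[] one has [|t| <= |x| + 1], so this exponential bounds the integrand from below. *)
apply: (@lt_le_trans _ _ (expR (- (`|x| + 1) ^+ 2) * fine (leb `[x, x + 1[%classic))).
  by rewrite fine_leb_itv// mulr_gt0 ?expR_gt0// addrAC subrr add0r.
rewrite -Rintegral_cst//; apply: le_Rintegral => //.
- apply: measurable_bounded_integrable => //.
    exact: leb_itv_lty.
  exists `|expR (- (`|x| + 1) ^+ 2)|; split; first exact: num_real.
  by move=> M /= M1 t _; rewrite ltW.
- exact: integrable_gauss.
move=> t /=; rewrite in_itv/= => /andP[xt tx]; rewrite ler_expR lerN2.
rewrite -[t ^+ 2]real_normK ?num_real// lerXn2r ?nnegrE//.
rewrite ler_norml; have := ler_norm x; have := ler_norm (- x); rewrite normrN.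
by move=> ? ?; apply/andP; split; lra.
Qed.

End erfc_facts.

Section normal_tails.
Context {R : realType} (sigma : R) (sigma0 : 0 < sigma).
Local Notation leb := (@lebesgue_measure R).
Local Notation s := (sigma * Num.sqrt 2).

Let s0 : 0 < s.
Proof. by rewrite mulr_gt0// sqrtr_gt0. Qed.

Let scale : R -> R := fun t => s * t.

Let scale' : scale^`()%classic = cst s.
Proof.
apply/funext => t; rewrite /scale derive1E deriveM//.
by rewrite derive_cst scaler0 addr0 derive_id /= -[LHS]/(s * 1) mulr1.
Qed.

Let normal_scale (t : R) :
  normal_pdf 0 sigma (s * t) * s = (Num.sqrt pi)^-1 * expR (- t ^+ 2).
Proof.
rewrite normal_pdfE ?gt_eqF// /normal_peak /normal_fun subr0.
have -> : - (s * t) ^+ 2 / (sigma ^+ 2 *+ 2) = - t ^+ 2.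
  rewrite !exprMn sqr_sqrtr// -mulr_natr; have : sigma != 0 by rewrite gt_eqF.
  by move=> ?; field.
have -> : sigma ^+ 2 * pi *+ 2 = s ^+ 2 * pi.
  by rewrite exprMn sqr_sqrtr// -mulr_natr; ring.
rewrite sqrtrM ?sqr_ge0// sqrtr_sqr gtr0_norm// invfM.
have s_neq0 : s != 0 by rewrite gt_eqF.
by rewrite mulrC !mulrA mulfV// mul1r.
Qed.

(** Rescaling by [s] turns the normal density into [expR (- t ^+ 2) / Num.sqrt pi], whereas [erfc]
    is normalised by [2 / Num.sqrt pi]; hence the factor [2^-1]. *)
Lemma normal_prob_ge a :
  normal_prob 0 sigma `[a, +oo[%classic = (2^-1 * erfc (a / s))%:E.
Proof.
rewrite /normal_prob.
have sa : scale (a / s) = a by rewrite /scale mulrC divfK// gt_eqF.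
rewrite -{1}sa increasing_ge0_integration_by_substitutiony; first last.
- by move=> x _; exact: normal_pdf_ge0.
- by apply: continuous_subspaceT; apply: continuous_normal_pdf; rewrite gt_eqF.
- exact: (gt0_cvgMry s0 (@cvg_id _ (pinfty_nbhs R))).
- split => [x _|]; first by [].
  by apply: cvg_at_right_filter; apply: cvgMr; exact: cvg_id.
- by rewrite scale'; exact: is_cvg_cst.
- by rewrite scale'; exact: is_cvg_cst.
- by move=> x _; rewrite scale'; exact: cvg_cst.
- by move=> x y _ _ xy; rewrite /scale ltr_pM2l.
under eq_integral => t _ do rewrite scale' fctE/= normal_scale EFinM.
rewrite integralZl//; last exact: integrable_gauss_tail.
have -> : (2^-1 * erfc (a / s))%:E =
    ((Num.sqrt pi)^-1 * \int[leb]_(t in `[a / s, +oo[) expR (- t ^+ 2))%:E.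
  by rewrite /erfc mulrA; congr (_ * _)%:E; field; rewrite sqrtr_eq0 -ltNge pi_gt0.
by rewrite EFinM /Rintegral fineK//; exact: gauss_tail_fin_num.
Qed.

Lemma normal_prob_le a :
  normal_prob 0 sigma `]-oo, a]%classic = (2^-1 * erfc (- a / s))%:E.
Proof.
rewrite -normal_prob_ge /normal_prob -[in LHS](opprK a).
rewrite ge0_integration_by_substitutionNy; first last.
- by move=> x _; exact: normal_pdf_ge0.
- by apply: continuous_subspaceT; apply: continuous_normal_pdf; rewrite gt_eqF.
apply: eq_integral => x _ /=; rewrite !normal_pdfE ?gt_eqF// /normal_fun.
by rewrite !subr0 sqrrN.
Qed.

Lemma normal_prob_gt a :
  normal_prob 0 sigma `]a, +oo[%classic = (2^-1 * erfc (a / s))%:E.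
Proof.
rewrite -normal_prob_ge /normal_prob integral_itv_obnd_cbnd//.
by apply: measurable_funTS; apply/measurable_EFinP; exact: measurable_normal_pdf.
Qed.

End normal_tails.
(** * The error kernel *)

Section error_kernel_integral.
Context {R : realType} (q w c sigma : R).

Local Notation A := (transfer q w (prob_up q w c sigma) (prob_down q w c sigma)).
Local Notation Pk k x := (error_kernel_iter q w c sigma k x).

(** Arbitrary components let one formula serve twice: with Dirac masses it is the one-step kernel,
    with [k]-step laws from the three possible moves it is the law after [k.+1] steps. *)
Let mixture (m1 m2 m3 : {measure set R -> \bar R}) (z : R) :=
  measure_add
    (measure_add (mscale (NngNum (prob_up_ge0 q w c sigma z)) m1)
                 (mscale (NngNum (prob_down_ge0 q w c sigma z)) m2))
    (mscale (NngNum (prob_stay_ge0 q w c sigma z)) m3).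

Let mixtureE m1 m2 m3 z B : mixture m1 m2 m3 z B =
  ((prob_up q w c sigma z)%:E * m1 B + (prob_down q w c sigma z)%:E * m2 B
   + (prob_stay q w c sigma z)%:E * m3 B)%E.
Proof.
by rewrite [LHS]measure_addE; congr (_ + _)%E; rewrite [LHS]measure_addE.
Qed.

Let integral_mixture m1 m2 m3 z (f : R -> \bar R) :
  (forall x, 0 <= f x)%E -> measurable_fun setT f ->
  (\int[mixture m1 m2 m3 z]_x f x =
   (prob_up q w c sigma z)%:E * \int[m1]_x f x
   + (prob_down q w c sigma z)%:E * \int[m2]_x f x
   + (prob_stay q w c sigma z)%:E * \int[m3]_x f x)%E.
Proof.
move=> f0 mf; rewrite ge0_integral_measure_add// ge0_integral_measure_add//.
by rewrite !ge0_integral_mscale.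
Qed.

Lemma integral_error_kernel (f : R -> R) z :
  (forall x, 0 <= f x) -> measurable_fun setT f ->
  (\int[error_kernel q w c sigma z]_x (f x)%:E)%E = (A f z)%:E.
Proof.
move=> f0 mf.
have mf' : measurable_fun setT (EFin \o f) by exact/measurable_EFinP.
have f0' y : (0 <= (EFin \o f) y)%E by rewrite lee_fin.
rewrite [LHS](integral_mixture \d_(q * z + w) \d_(q * z - w) \d_(q * z) z)//.
by rewrite !integral_dirac// !diracT !mul1e.
Qed.

Lemma measurable_transfer f : measurable_fun setT f -> measurable_fun setT (A f).
Proof.
move=> mf; have mlin a : measurable_fun setT (fun z : R => f (q * z + a)).
  by apply: (measurableT_comp mf); apply: measurable_funD => //;
    exact: measurable_funM.
have mlin0 : measurable_fun setT (fun z : R => f (q * z)).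
  by apply: (measurableT_comp mf); exact: measurable_funM.
by apply: measurable_funD; first apply: measurable_funD; apply: measurable_funM => //;
  [exact: measurable_prob_up|exact: measurable_prob_down|exact: measurable_prob_stay].
Qed.

Lemma transfer_ge0 f : (forall x, 0 <= f x) -> forall x, 0 <= A f x.
Proof.
move=> f0 x; rewrite !addr_ge0// mulr_ge0//; first exact: prob_up_ge0.
  exact: prob_down_ge0.
exact: prob_stay_ge0.
Qed.

Lemma integral_error_kernel_iter k (f : R -> R) x :
  (forall y, 0 <= f y) -> measurable_fun setT f ->
  (\int[Pk k x]_y (f y)%:E)%E = (iter k A f x)%:E.
Proof.
elim: k f x => [|k IH] f x f0 mf.
  by rewrite [LHS]integral_dirac ?diracT ?mul1e//; exact/measurable_EFinP.
have indE B y : measurable B ->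
    error_kernel q w c sigma y B = (A (\1_B) y)%:E.
  move=> mB; rewrite -integral_error_kernel//.
  by rewrite integral_indic// setIT.
have PkE (y : R) B : measurable B -> Pk k y B = (iter k A (\1_B) y)%:E.
  by move=> mB; rewrite -IH// integral_indic// setIT.
(* The iterated kernel appends its new step at the end, while the mixture splits off the first one.
   On indicators both are [iter k.+1 A], read from either side through [iterSr]. *)
rewrite (eq_measure_integral
  (mixture (Pk k (q * x + w)) (Pk k (q * x - w)) (Pk k (q * x)) x)); last first.
  move=> B mB _; rewrite [RHS]mixtureE !PkE//.
  transitivity (\int[Pk k x]_y (error_kernel q w c sigma y B))%E; first by [].
  under eq_integral => y _ do rewrite indE//.
  rewrite IH//; first by rewrite -iterSr.
  - by apply: transfer_ge0.
  - by apply: measurable_transfer; exact: measurable_indic.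
have mf' : measurable_fun setT (EFin \o f) by exact/measurable_EFinP.
have f0' y : (0 <= (EFin \o f) y)%E by rewrite lee_fin.
rewrite integral_mixture//.
by rewrite !IH.
Qed.

End error_kernel_integral.
Section error_chain.
Context {R : realType} (q w c sigma : R).
Hypotheses (q0 : 0 < q) (q1 : q < 1) (w0 : 0 < w) (sigma0 : 0 < sigma).

Local Notation pu := (prob_up q w c sigma).
Local Notation pd := (prob_down q w c sigma).
Local Notation A := (transfer q w pu pd).
Local Notation b := (w / (1 - q)).
Local Notation s := (sigma * Num.sqrt 2).
Local Notation Pk k x := (error_kernel_iter q w c sigma k x).

Let s0 : 0 < s.
Proof. by rewrite mulr_gt0// sqrtr_gt0. Qed.

Let b0 : 0 < b := radius_gt0 q1 w0.

Definition prob_lip : R := 4^-1 * (2 / Num.sqrt pi * (`|c * q| / s)).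

Lemma prob_lip_ge0 : 0 <= prob_lip.
Proof. by rewrite !mulr_ge0 ?invr_ge0 ?sqrtr_ge0// ltW. Qed.

Let erfc_affine_lip (a d x y : R) : `|a| = `|c * q| ->
  `|4^-1 * erfc ((a * x + d) / s) - 4^-1 * erfc ((a * y + d) / s)|
    <= prob_lip * `|x - y|.
Proof.
move=> ac; rewrite -mulrBr normrM ger0_norm// /prob_lip -!mulrA ler_pM2l//.
apply: le_trans (erfc_lip _ _) _.
rewrite -!mulrA ler_pM2l// ler_wpM2l ?invr_ge0 ?sqrtr_ge0//.
rewrite -mulrBl normrM (_ : a * x + d - (a * y + d) = a * (x - y)); last by ring.
by rewrite normrM ac (gtr0_norm (_ : 0 < s^-1)) ?invr_gt0// -mulrA (mulrC `|x - y|).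
Qed.

Lemma prob_up_lip x y : `|pu x - pu y| <= prob_lip * `|x - y|.
Proof. exact: erfc_affine_lip. Qed.

Lemma prob_down_lip x y : `|pd x - pd y| <= prob_lip * `|x - y|.
Proof.
have pdE z : pd z = 4^-1 * erfc ((- (c * q) * z + c * w / 2) / s).
  by rewrite /prob_down mulNr.
by rewrite !pdE; apply: erfc_affine_lip; rewrite normrN.
Qed.

(** The joint-jump probability of the coupling: [erfc] at an upper bound for its argument over the
    ball, positive because the Gaussian tail never vanishes. *)
Definition prob_up_min : R := 4^-1 * erfc ((`|c * q| * b + c * w / 2) / s).

Lemma prob_up_min_gt0 : 0 < prob_up_min.
Proof. by rewrite mulr_gt0// erfc_gt0. Qed.

Lemma prob_up_minP (z : R) : `|z| <= b -> prob_up_min <= pu z.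
Proof.
move=> zb; rewrite ler_pM2l//; apply: erfc_nonincreasing.
rewrite ler_pM2r ?invr_gt0// lerD2r; apply: le_trans (ler_norm _) _.
by rewrite normrM ler_wpM2l.
Qed.

Lemma prob_up_min_le1 : prob_up_min <= 1.
Proof.
rewrite /prob_up_min mulrC ler_pdivrMr// mul1r.
by apply: le_trans (erfc_le2 _) _; rewrite ler_nat.
Qed.

Let pu0 := prob_up_ge0 q w c sigma.
Let pd0 := prob_down_ge0 q w c sigma.
Let ps0 := prob_stay_ge0 q w c sigma.

Definition error_mean : (R -> R) -> R := ergodic_mean q w pu pd.

Lemma error_mean_close e : 0 < e -> exists k0, forall k f L, (k0 <= k)%N ->
  0 <= L -> lip_ball b L f ->
  forall x : R, `|x| <= b -> `|iter k A f x - error_mean f| <= e * L.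
Proof.
exact: (ergodic_mean_close q0 q1 w0 pu0 pd0 ps0 prob_up_min_gt0 prob_up_min_le1
  prob_up_minP prob_lip_ge0 prob_up_lip prob_down_lip).
Qed.

Lemma posfun_error_mean : posfun b error_mean.
Proof.
split.
- exact: ergodic_mean_cst.
- move=> f g [L L0 fL] [M M0 gM].
  exact: (ergodic_meanD q0 q1 w0 pu0 pd0 ps0 prob_up_min_gt0 prob_up_min_le1
    prob_up_minP prob_lip_ge0 prob_up_lip prob_down_lip L0 M0).
- move=> a f [L L0 fL].
  exact: (ergodic_meanZ q0 q1 w0 pu0 pd0 ps0 prob_up_min_gt0 prob_up_min_le1
    prob_up_minP prob_lip_ge0 prob_up_lip prob_down_lip a L0).
- move=> f g [L L0 fL] [M M0 gM].
  exact: (ergodic_mean_le q0 q1 w0 pu0 pd0 ps0 prob_up_min_gt0 prob_up_min_le1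
    prob_up_minP prob_lip_ge0 prob_up_lip prob_down_lip L0 M0).
Qed.

Lemma lipb_cond_err : lipb b (cond_err q w c sigma).
Proof.
apply: (@lipbD _ _ pu pd); exists prob_lip; try exact: prob_lip_ge0.
  by move=> x y _ _; exact: prob_up_lip.
by move=> x y _ _; exact: prob_down_lip.
Qed.

Lemma lip_ballP (f : R -> R) : 1.-lipschitz_(error_dom q w) f -> lip_ball b 1 f.
Proof.
by move=> fD x y /domP xb /domP yb; exact: (fD (x, y)).
Qed.

Lemma measurable_error_dom : measurable (error_dom q w).
Proof. exact: measurable_itv. Qed.
Hint Resolve measurable_error_dom : core.

(** On the invariant ball the indicator of [error_dom] agrees with the constant 1, which [transfer]
    fixes. *)
Lemma error_kernel_iter_dom k (x : R) : `|x| <= b ->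
  Measure.sort (Pk k x) (error_dom q w) = 1%E.
Proof.
move=> xb; rewrite -(setIT (error_dom q w)) -integral_indic//.
rewrite integral_error_kernel_iter//.
rewrite (iter_transfer_eq q0 q1 w0 pu0 pd0 ps0 (g := cst 1) k _ xb).
  by rewrite iter_transfer_cst.
by move=> z /domP zb; rewrite indicE mem_set.
Qed.

(* [f] is only controlled on [error_dom], where it may be negative: the nonnegative
   measurable function used on the whole line is [f + M] cut off outside it. *)
Lemma integral_dom_iter k (f : R -> R) (x : R) : lipb b f -> `|x| <= b ->
  (\int[Pk k x]_(y in error_dom q w) (f y)%:E)%E = (iter k A f x)%:E.
Proof.
move=> lf xb; have [M fM] := lipb_bound b0 lf.
have PD := error_kernel_iter_dom k xb.
have PD' : (Measure.sort (Pk k x) (error_dom q w) < +oo)%E by rewrite PD ltry.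
pose g := f \+ cst M; pose h := (g \_ (error_dom q w)) : R -> R.
have lg : lipb b g by apply: lipbD => //; exact: lipb_cst.
have h0 y : 0 <= h y.
  rewrite /h patchE; case: ifPn => // /set_mem /domP yb.
  by have := fM _ yb; rewrite ler_norml => /andP[? _]; rewrite /g/=; lra.
have gE : (\int[Pk k x]_(y in error_dom q w) (g y)%:E)%E = (iter k A f x + M)%:E.
  rewrite -[M in RHS]/(cst M x) -(iter_transfer_cst q w pu pd k M).
  rewrite -[_ + _ in RHS]/((iter k A f \+ iter k A (cst M)) x) -iter_transferD -/g.
  rewrite -(iter_transfer_eq q0 q1 w0 pu0 pd0 ps0 (f := h) k _ xb); last first.
    by move=> z /domP zb; rewrite /h patchE mem_set.
  rewrite -integral_error_kernel_iter//.
    by rewrite integral_mkcond; apply: eq_integral => y _; rewrite /h !patchE; case: ifP.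
  by apply/(measurable_restrictT _ _).1 => //; exact: lipb_measurable.
have : (\int[Pk k x]_(y in error_dom q w) (g y)%:E)%E =
  (\int[Pk k x]_(y in error_dom q w) (f y)%:E + M%:E)%E.
  under eq_integral do rewrite EFinD.
  rewrite integralD//; [|exact: lipb_integrable|].
    congr (_ + _)%E.
    transitivity (M%:E * Measure.sort (Pk k x) (error_dom q w))%E.
      exact: (integral_cst (Pk k x) measurable_error_dom M%:E).
    by rewrite PD mule1.
  by apply: (@lipb_integrable _ _ b0 _ (cst M)) => //; exact: lipb_cst.
rewrite gE => H.
have ffin : (\int[Pk k x]_(y in error_dom q w) (f y)%:E)%E \is a fin_num.
  by apply: integrable_fin_num => //; exact: lipb_integrable.
move: H; rewrite -(fineK ffin) -EFinD => -[/addIr ->].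
by [].
Qed.

End error_chain.

(** * Existence and uniqueness of the Kantorovich limit *)

Lemma cvge0P {R : realType} (u : nat -> \bar R) : (forall k, 0 <= u k)%E ->
  u @ \oo --> 0%E <-> forall e : R, 0 < e -> \forall k \near \oo, (u k <= e%:E)%E.
Proof.
move=> u0; split => [/fine_cvgP[ufin /cvgr0Pnorm_le ucv] e e0|H].
  have := ucv e e0; apply: filterS2 ufin => k ukfin.
  rewrite /= -(lee_fin _ e) => /(le_trans _); apply.
  by rewrite -{1}(fineK ukfin) lee_fin ler_norm.
apply/fine_cvgP; split.
  apply: filterS (H 1 ltr01) => k uk1.
  by rewrite ge0_fin_numE//; exact: le_lt_trans uk1 (ltry _).
apply/cvgr0Pnorm_le => e e0; apply: filterS (H e e0) => k uke /=.
have ukfin : u k \is a fin_num by rewrite ge0_fin_numE//; exact: le_lt_trans uke (ltry _).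
by rewrite ger0_norm ?fine_ge0// -lee_fin fineK.
Qed.

Section stationary.
Context {R : realType} (q w c sigma : R).
Hypotheses (q0 : 0 < q) (q1 : q < 1) (w0 : 0 < w) (sigma0 : 0 < sigma).

Local Notation b := (w / (1 - q)).
Local Notation D := (error_dom q w).
Local Notation A := (transfer q w (prob_up q w c sigma) (prob_down q w c sigma)).
Local Notation Pk k x := (error_kernel_iter q w c sigma k x).
Local Notation m mu := (@Measure.sort _ R R mu).

Let b0 : 0 < b := radius_gt0 q1 w0.

Let lip1_lipb (f : R -> R) : 1.-lipschitz_D f -> lipb b f.
Proof. by move=> /lip_ballP; exists 1. Qed.

Let cst0_lip : 1.-lipschitz_D (cst 0 : R -> R).
Proof. by move=> [x y] _ /=; rewrite subrr normr0 mul1r. Qed.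

Let zero_dom : `|0 : R| <= b.
Proof. by rewrite normr0 ltW. Qed.

Let kantorovich_term (mu : probability R R) k (x : R) f : m mu D = 1%E ->
  `|x| <= b -> 1.-lipschitz_D f ->
  (`|(\int[Pk k x]_(y in D) (f y)%:E) - (\int[mu]_(y in D) (f y)%:E)|
   = `|iter k A f x - intf b mu f|%:E)%E.
Proof.
move=> muD xb /lip1_lipb lf; rewrite integral_dom_iter//.
by rewrite (intfE b0 muD lf).
Qed.

Let kantorovich_sup_ge (mu : probability R R) k (x : R) f : m mu D = 1%E ->
  `|x| <= b -> 1.-lipschitz_D f -> (`|iter k A f x - intf b mu f|%:E <=
    ereal_sup [set kantorovich D (Pk k x) mu | x in D])%E.
Proof.
move=> muD xb fD; apply: le_ereal_sup_tmp; exists (kantorovich D (Pk k x) mu).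
  by exists x => //; exact/domP.
apply: le_ereal_sup_tmp; exists (`|iter k A f x - intf b mu f|%:E) => //.
by exists f => //; exact: kantorovich_term.
Qed.

Let kantorovich_sup_ge0 (mu : probability R R) k : m mu D = 1%E ->
  (0 <= ereal_sup [set kantorovich D (Pk k x) mu | x in D])%E.
Proof.
by move=> muD; apply: le_trans (kantorovich_sup_ge k muD zero_dom cst0_lip);
  rewrite lee_fin.
Qed.

Lemma error_mean_cvg_kantorovich (mu : probability R R) : m mu D = 1%E ->
  (forall f, lipb b f -> intf b mu f = error_mean q w c sigma f) ->
  cvg_kantorovich D (fun k x => Pk k x) mu.
Proof.
move=> muD muE; apply/cvge0P => [k|e e0]; first exact: kantorovich_sup_ge0.
have [k0 Hk] := error_mean_close c q0 q1 w0 sigma0 e0.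
exists k0 => // k /= kk0; apply: ge_ereal_sup => _ [x /domP xb <-].
apply: ge_ereal_sup => _ [f /= fD <-].
rewrite kantorovich_term// lee_fin muE; last exact: lip1_lipb.
by rewrite -[e]mulr1; apply: Hk => //; exact: lip_ballP.
Qed.

Lemma kantorovich_limit_unique (mu nu : probability R R) :
  m mu D = 1%E -> m nu D = 1%E ->
  cvg_kantorovich D (fun k x => Pk k x) mu ->
  cvg_kantorovich D (fun k x => Pk k x) nu ->
  forall B, measurable B -> m mu B = m nu B.
Proof.
move=> muD nuD.
move=> /(cvge0P (fun k => kantorovich_sup_ge0 k muD)) Hmu.
move=> /(cvge0P (fun k => kantorovich_sup_ge0 k nuD)) Hnu.
have eq1 f : 1.-lipschitz_D f -> intf b mu f = intf b nu f.
  move=> fD; apply/eqP; rewrite -subr_eq0 -normr_le0.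
  apply/ler_addgt0Pr => e e0; rewrite add0r.
  have e20 : 0 < e / 2 by rewrite divr_gt0.
  have [k _ /(_ k (leqnn k))[]] := filterI (Hmu _ e20) (Hnu _ e20).
  move=> /(le_trans (kantorovich_sup_ge k muD zero_dom fD)); rewrite lee_fin => H1.
  move=> /(le_trans (kantorovich_sup_ge k nuD zero_dom fD)); rewrite lee_fin => H2.
  move: H1 H2; rewrite !ler_norml => /andP[? ?] /andP[? ?].
  by apply/andP; split; lra.
apply: (prob_unique b0 muD nuD) => y e e0.
have lr := lipb_ramp b y e0.
(* The ramp has Lipschitz constant [e^-1]; scaling by [e] makes it an admissible test function, and
   [e] is cancelled at the end. *)
have : intf b mu (e \o* ramp y e) = intf b nu (e \o* ramp y e).
  apply: eq1 => -[x x'] [/= _ _]; rewrite -mulrBl normrM (gtr0_norm e0) mul1r.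
  (* The radius [|x| + |x'|] only serves to place both points in one ball. *)
  rewrite -ler_pdivlMr// mulrC; apply: (lip_ramp (r := `|x| + `|x'|)) => //.
    by rewrite lerDl.
  by rewrite lerDr.
rewrite (posfunZ (posfun_intf b0 muD) _ lr) (posfunZ (posfun_intf b0 nuD) _ lr).
by apply: mulIf; rewrite gt_eqF.
Qed.

Lemma stationary_measure : exists mu : probability R R,
  [/\ m mu D = 1%E,
      forall f, lipb b f -> intf b mu f = error_mean q w c sigma f,
      cvg_kantorovich D (fun k x => Pk k x) mu &
      forall nu : probability R R, m nu D = 1%E ->
        cvg_kantorovich D (fun k x => Pk k x) nu ->
        forall B, measurable B -> m nu B = m mu B].
Proof.
have [mu muD muE] := posfun_measure b0 (posfun_error_mean c q0 q1 w0 sigma0).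
have cmu := error_mean_cvg_kantorovich muD muE.
exists mu; split => // nu nuD cnu B mB.
exact: kantorovich_limit_unique.
Qed.

End stationary.
(** * The law of the decoding errors *)

Section independence_facts.
Context {d d' : measure_display} {T : measurableType d} {T' : measurableType d'}.

Lemma gen_sigma_algebra_bigcap (X : nat -> T -> T') (J : seq nat) (E : nat -> set T) :
  (forall i, i \in J -> g_sigma_algebra_preimage (X i) (E i)) ->
  gen_sigma_algebra X (\bigcap_(i in [set` J]) E i).
Proof.
move=> XE; pose G := \bigcup_i g_sigma_algebra_preimage (X i).
apply: (@bigcap_measurableType _ (g_sigma_algebraType G)) => i /= iJ.
by apply: sub_sigma_algebra; exists i => //; exact: XE.
Qed.

End independence_facts.

Section decoding.
Context {R : realType} (q w c sigma : R) (sigma0 : 0 < sigma)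
  {d : measure_display} {T : measurableType d} (P : probability T R)
  (U : nat -> {RV P >-> bool}) (N : nat -> {RV P >-> R}) (xh0 : R).
Hypotheses
  (hU : forall (k : nat) (A : set bool),
    distribution P (U k) A = bernoulli_prob (2^-1 : R) A)
  (hN : forall (k : nat) (A : set R), measurable A ->
    distribution P (N k.+1) A = normal_prob 0 sigma A)
  (indepU : independent_rvs P (fun k : nat => U k))
  (indepN : independent_rvs P (fun k : nat => N k.+1))
  (indepUN : independent_families P (fun k : nat => U k)
                                    (fun k : nat => N k.+1)).

Local Notation st := (state q w (fun k => U k)).
Local Notation est := (state_est q w c (fun k => U k) (fun k => N k) xh0).
Local Notation uh := (input_est q w c (fun k => U k) (fun k => N k) xh0).
Local Notation up := (prob_up q w c sigma).
Local Notation down := (prob_down q w c sigma).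
Local Notation A := (transfer q w up down).
Local Notation s := (sigma * Num.sqrt 2).
Local Notation pr S := (fine (@Measure.sort _ T R P S)).

(** The bits [U 0], ..., [U k.-1] and the noises [N 1], ..., [N k] are the randomness that enters
    the error at time [k]; separate constraints on each are what independence multiplies. *)
Definition cylinder k (a : nat -> set bool) (B : nat -> set R) : set T :=
  \bigcap_(i in [set` iota 0 k]) (U i @^-1` a i) `&`
  \bigcap_(i in [set` iota 0 k]) (N i.+1 @^-1` B i).

Let mU k (a : set bool) : measurable (U k @^-1` a).
Proof. exact: measurable_funPTI. Qed.

Let mN k (B : set R) : measurable B -> measurable (N k @^-1` B).
Proof. by move=> mB; exact: measurable_funPTI. Qed.

Lemma measurable_cylinder k a B : (forall i, measurable (B i)) ->
  measurable (cylinder k a B).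
Proof.
by move=> mB; apply: measurableI; apply: bigcap_measurableType => i _;
  [exact: mU|exact: mN].
Qed.

Lemma cylinder_prob k a B : (forall i, measurable (B i)) ->
  P (cylinder k a B) =
  (\prod_(i <- iota 0 k) P (U i @^-1` a i) *
   \prod_(i <- iota 0 k) P (N i.+1 @^-1` B i))%E.
Proof.
move=> mB.
have gU i : i \in iota 0 k -> g_sigma_algebra_preimage (U i) (U i @^-1` a i).
  by move=> _; exists (a i) => //; rewrite setTI.
have gN i : i \in iota 0 k -> g_sigma_algebra_preimage (N i.+1) (N i.+1 @^-1` B i).
  by move=> _; exists (B i) => //; rewrite setTI.
rewrite indepUN; [|exact: gen_sigma_algebra_bigcap|
  exact: (gen_sigma_algebra_bigcap (X := fun k => N k.+1))].
by rewrite indepU ?iota_uniq// indepN ?iota_uniq.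
Qed.

Let upd {V : Type} (f : nat -> V) k v := fun i => if i == k then v else f i.

Let cylinderS k a B (x : set bool) (y : set R) :
  cylinder k.+1 (upd a k x) (upd B k y) =
  cylinder k a B `&` (U k @^-1` x `&` N k.+1 @^-1` y).
Proof.
have lt_iota n i : [set` iota 0 n] i <-> (i < n)%N by rewrite /mkset mem_iota.
apply/seteqP; split => t.
  move=> [ta tB]; split; last first.
    have kk : [set` iota 0 k.+1] k by apply/lt_iota.
    by split; [have := ta k kk|have := tB k kk]; rewrite /upd eqxx.
  split => i /lt_iota ik; have ik' : [set` iota 0 k.+1] i by apply/lt_iota/ltnW.
    by have := ta i ik'; rewrite /upd ltn_eqF.
  by have := tB i ik'; rewrite /upd ltn_eqF.
move=> [[ta tB] [tx ty]]; split => i /lt_iota; rewrite ltnS leq_eqVlt /upd.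
  by case: eqVneq => [->//|_ /= ik]; apply: ta; exact/lt_iota.
by case: eqVneq => [->//|_ /= ik]; apply: tB; exact/lt_iota.
Qed.

Definition is_cylinder k (E : set T) : Prop :=
  exists a B, (forall i, measurable (B i)) /\ E = cylinder k a B.

Lemma is_cylinder_measurable k E : is_cylinder k E -> measurable E.
Proof. by move=> [a [B [mB ->]]]; exact: measurable_cylinder. Qed.

Lemma is_cylinder0 : is_cylinder 0 setT.
Proof.
exists (fun=> setT), (fun=> setT); split => //.
by apply/esym/seteqP; split => // t _; split.
Qed.

Lemma is_cylinderS k E x y : measurable y -> is_cylinder k E ->
  is_cylinder k.+1 (E `&` (U k @^-1` x `&` N k.+1 @^-1` y)).
Proof.
move=> my [a [B [mB ->]]]; exists (upd a k x), (upd B k y); split.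
  by move=> i; rewrite /upd; case: ifP.
by rewrite cylinderS.
Qed.

(** The form of the Markov property used here: the next bit and noise are independent of each other
    and of the past recorded in [E]. *)
Lemma is_cylinder_prob k E x y : measurable y -> is_cylinder k E ->
  pr (E `&` (U k @^-1` x `&` N k.+1 @^-1` y)) =
  pr E * (fine (bernoulli_prob (2^-1 : R) x) * fine (normal_prob 0 sigma y)).
Proof.
move=> my [a [B [mB ->]]].
have mB' i : measurable (upd B k y i) by rewrite /upd; case: ifP.
have updE (V : Type) (f : nat -> V) v i : i \in iota 0 k -> upd f k v i = f i.
  by rewrite mem_iota/= /upd => ik; rewrite ltn_eqF.
rewrite -cylinderS.
have -> : pr (cylinder k.+1 (upd a k x) (upd B k y)) = fine
   (\prod_(i <- iota 0 k) P (U i @^-1` a i) * P (U k @^-1` x) *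
   (\prod_(i <- iota 0 k) P (N i.+1 @^-1` B i) * P (N k.+1 @^-1` y)))%E.
  congr fine; rewrite [LHS]cylinder_prob//.
  rewrite -[in LHS](addn1 k) iotaD/= !big_cat/= !big_seq1 add0n.
  congr (_ * _ * (_ * _))%E.
  - by apply: eq_big_seq => i ik; rewrite updE.
  - by rewrite /upd eqxx.
  - by apply: eq_big_seq => i ik; rewrite updE.
  - by rewrite /upd eqxx.
have -> : pr (cylinder k a B) = fine
   (\prod_(i <- iota 0 k) P (U i @^-1` a i) *
    \prod_(i <- iota 0 k) P (N i.+1 @^-1` B i))%E.
  by congr fine; exact: cylinder_prob.
have -> : bernoulli_prob (2^-1 : R) x = P (U k @^-1` x) by rewrite -(hU k).
have -> : normal_prob 0 sigma y = P (N k.+1 @^-1` y) by rewrite -(hN k).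
have fU i v : P (U i @^-1` v) \is a fin_num by rewrite fin_num_measure.
have fN i v : measurable v -> P (N i @^-1` v) \is a fin_num.
  by move=> mv; rewrite fin_num_measure//; exact: mN.
have f1 : (\prod_(i <- iota 0 k) P (U i @^-1` a i))%E \is a fin_num.
  by apply: (big_ind (fun x : \bar R => x \is a fin_num)) => //; exact: fin_numM.
have f2 : (\prod_(i <- iota 0 k) P (N i.+1 @^-1` B i))%E \is a fin_num.
  by apply: (big_ind (fun x : \bar R => x \is a fin_num)) => //;
    [exact: fin_numM|move=> i _; exact: fN].
rewrite !fineM ?fin_numM ?fU ?fN//.
by ring.
Qed.

Lemma decideE (xh y : R) : decide q w c xh y = (c * q * xh + c * w / 2 < y)%R%:R.
Proof. by rewrite /decide indicE mem_setE in_itv/= andbT. Qed.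

Let measurable_decide (f g : T -> R) : measurable_fun setT f ->
  measurable_fun setT g -> measurable_fun setT (fun t => decide q w c (f t) (g t)).
Proof.
move=> mf mg.
(* The threshold is random, so it is moved to the other side, leaving the indicator of a fixed
   half-line. *)
rewrite (_ : (fun t => _) = (\1_(`]0, +oo[%classic : set R) \o
    (fun t => g t - (c * q * f t + c * w / 2)))); last first.
  apply/funext => t; rewrite decideE /= indicE mem_setE in_itv/= andbT.
  by rewrite subr_gt0.
apply: measurableT_comp => //; apply: measurable_funB => //.
by apply: measurable_funD => //; exact: measurable_funM.
Qed.

Let measurable_bit k : measurable_fun setT (fun t => (U k t)%:R : R).
Proof.
have mb : measurable_fun setT (fun x : bool => x%:R : R) by [].
by apply: (measurableT_comp mb).
Qed.

Let measurable_state k : measurable_fun setT (st k).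
Proof.
elim: k => [|k IH] /=; first exact: measurable_cst.
by apply: measurable_funD; apply: measurable_funM.
Qed.

Let measurable_output k : measurable_fun setT
  (output q w c (fun k => U k) (fun k => N k) k).
Proof. by apply: measurable_funD => //; apply: measurable_funM. Qed.

Let measurable_state_est k : measurable_fun setT (est k).
Proof.
elim: k => [|k IH] /=; first exact: measurable_cst.
apply: measurable_funD; first exact: measurable_funM.
by apply: measurable_funM => //; exact: measurable_decide.
Qed.

Let measurable_input_est k : measurable_fun setT (uh k).
Proof. exact: measurable_decide. Qed.

Definition error_event k : set T := [set t | (U k t)%:R != uh k t].

Lemma measurable_error_event k : measurable (error_event k).
Proof.
rewrite (_ : error_event k =
    (fun t => (U k t)%:R - uh k t) @^-1` (~` [set 0])); last first.
  apply/seteqP; split => t; rewrite /error_event /= -subr_eq0; first by move/eqP.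
  by move=> /eqP.
rewrite -[X in measurable X]setTI.
by apply: measurable_funB => //; exact: measurableC.
Qed.

Let pr_split S H : measurable S -> measurable H ->
  pr S = pr (S `&` H) + pr (S `&` ~` H).
Proof.
move=> mS mH; rewrite -fineD ?fin_num_measure//; first last.
- by apply: measurableI => //; exact: measurableC.
- exact: measurableI.
by rewrite -setDE addeC -measureDI.
Qed.

Section one_step.
Variables (k : nat) (E : set T) (x xh : R).
Hypotheses (cE : is_cylinder k E)
  (Ex : forall t, E t -> st k t = x /\ est k t = xh).

Let z := xh - x.
(* Given the bit [u], the decision is 1 iff the noise exceeds [thr u]. *)
Let thr (u : bool) : R := c * q * z + c * w / 2 - c * w * u%:R.

Let noise (u a : bool) : set R :=
  if a then `]thr u, +oo[%classic else `]-oo, thr u]%classic.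

Let piece (u a : bool) : set T :=
  E `&` (U k @^-1` [set u] `&` N k.+1 @^-1` noise u a).

Let measurable_noise u a : measurable (noise u a).
Proof. by rewrite /noise; case: a. Qed.

Let noiseC u : ~` noise u true = noise u false.
Proof. by rewrite /noise setCitvr. Qed.

(** State and estimate are constant on [E], so [thr u] is a number and prescribing the decision
    constrains [N k.+1] alone: the induction never leaves cylinders. *)
Let cylinder_piece u a : is_cylinder k.+1 (piece u a).
Proof. by apply: is_cylinderS => //; exact: measurable_noise. Qed.

Let pr_split4 S : measurable S -> pr (E `&` S) =
  pr (piece true true `&` S) + pr (piece true false `&` S) +
  pr (piece false true `&` S) + pr (piece false false `&` S).
Proof.
move=> mS; have mE := is_cylinder_measurable cE.
have mES : measurable (E `&` S) by exact: measurableI.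
have mESu u : measurable (E `&` S `&` U k @^-1` [set u]) by exact: measurableI.
have pieceE u a : piece u a `&` S =
    E `&` S `&` U k @^-1` [set u] `&` N k.+1 @^-1` noise u a.
  by rewrite /piece; apply/seteqP; split => t /=; tauto.
rewrite (pr_split mES (mU k [set true])).
have -> : E `&` S `&` ~` (U k @^-1` [set true]) = E `&` S `&` U k @^-1` [set false].
  by congr (_ `&` _); apply/seteqP; split => t /=; case: (U k t).
rewrite (pr_split (mESu true) (mN k.+1 (measurable_noise true true))).
rewrite (pr_split (mESu false) (mN k.+1 (measurable_noise false true))).
have NC u : ~` (N k.+1 @^-1` noise u true) = N k.+1 @^-1` noise u false.
  by rewrite -noiseC.
by rewrite !NC !pieceE !addrA.
Qed.

Let bern_half u : fine (bernoulli_prob (2^-1 : R) [set u]) = 2^-1.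
Proof.
rewrite bernoulli_probE; last by rewrite invr_ge0 ler0n invf_le1 ?ler1n ?ltr0n.
have dE (a v : bool) : \d_a [set v] = ((a == v)%:R)%:E :> \bar R.
  rewrite diracE; case: eqVneq => [->|/eqP av]; first by rewrite mem_set.
  by rewrite memNset.
by case: u; rewrite !dE /= /unstable.onem; lra.
Qed.

Let normal_compl u : fine (normal_prob 0 sigma (noise u false)) =
  1 - fine (normal_prob 0 sigma (noise u true)).
Proof.
rewrite -noiseC probability_setC//; last exact: measurable_noise.
by rewrite fineB // fin_num_measure //; exact: measurable_noise.
Qed.

(** Each bit has probability [2^-1], and given the bit a wrong decision has probability [2 * up z]
    or [2 * down z]. A wrong 1 raises the error and a wrong 0 lowers it. *)
Let pr_piece u a : pr (piece u a) = pr E *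
  (if a == u then 2^-1 - (if u then down z else up z)
   else if u then down z else up z).
Proof.
rewrite (is_cylinder_prob [set u] (measurable_noise u a) cE).
rewrite bern_half; congr (_ * _).
have up_noise : fine (normal_prob 0 sigma (noise false true)) = 2 * up z.
  rewrite /noise normal_prob_gt//= /thr mulr0 subr0 /prob_up.
  by rewrite [RHS]mulrA; congr (_ * _); lra.
have down_noise : fine (normal_prob 0 sigma (noise true false)) = 2 * down z.
  rewrite /noise normal_prob_le//= /thr mulr1 /prob_down [RHS]mulrA; congr (_ * _).
    by lra.
  by have -> : - (c * q * z + c * w / 2 - c * w) = - (c * q * z) + c * w / 2 by lra.
have := normal_compl true; have := normal_compl false.
rewrite up_noise down_noise => fC tC.
case: u a => -[] /=; rewrite ?up_noise ?down_noise ?fC; first by move: tC; lra.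
all: by lra.
Qed.

Let piece_input_est u a t : piece u a t -> U k t = u /\ uh k t = a%:R.
Proof.
move=> [/Ex [tx txh] [/= tu tn]]; split => //.
rewrite /input_est decideE txh /output /= tx tu.
have -> : (c * q * xh + c * w / 2 < c * (q * x + w * u%:R) + N k.+1 t) =
    (thr u < N k.+1 t).
  by rewrite -subr_gt0 -[RHS]subr_gt0; congr (0 < _); rewrite /thr /z; ring.
move: tn; rewrite /noise; case: a => /=; rewrite in_itv/= ?andbT.
  by move=> ->.
by rewrite leNgt => /negbTE ->.
Qed.

Let piece_step u a t : piece u a t ->
  st k.+1 t = q * x + w * u%:R /\ est k.+1 t = q * xh + w * a%:R.
Proof.
move=> pt; have [tu ta] := piece_input_est pt; case: pt => /Ex[tx txh] _.
by rewrite /= tx txh tu -ta /input_est txh.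
Qed.

Lemma one_step_base : pr (E `&` error_event k) = pr E * cond_err q w c sigma z.
Proof.
rewrite pr_split4; last exact: measurable_error_event.
have diag u : piece u u `&` error_event k = set0.
  rewrite -subset0 => t [/piece_input_est[tu ta]].
  by rewrite /error_event /= tu ta eqxx.
have offdiag u : piece u (~~ u) `&` error_event k = piece u (~~ u).
  apply/setIidl => t /piece_input_est[tu ta].
  by rewrite /error_event /= tu ta; case: (u); rewrite ?oner_eq0// eq_sym oner_eq0.
rewrite !diag (offdiag true) (offdiag false) measure0 !pr_piece/=.
by rewrite /cond_err; ring.
Qed.

(** Backward equation: if the conditional probability of [S] is [h] of the next error on every
    longer cylinder, it is [A h] of the present one. The two pieces with a correct decision share
    the move [q * z]. *)
Lemma one_step_transfer S h : measurable S ->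
  (forall F y yh, is_cylinder k.+1 F ->
     (forall t, F t -> st k.+1 t = y /\ est k.+1 t = yh) ->
     pr (F `&` S) = pr F * h (yh - y)) ->
  pr (E `&` S) = pr E * A h z.
Proof.
move=> mS H; rewrite pr_split4//.
rewrite !(H _ _ _ (cylinder_piece _ _) (@piece_step _ _)) !pr_piece/=.
have zE u a : q * xh + w * a - (q * x + w * u) = q * z + w * (a - u).
  by rewrite /z; ring.
rewrite !zE !subrr mulr0 !subr0 sub0r addr0 mulr1 mulrN1 /transfer.
by set h0 := h _; field.
Qed.

End one_step.

(** Stated from an arbitrary cylinder at an arbitrary time, since each induction step lengthens the
    cylinder by one while the remaining horizon shrinks by one. *)
Lemma error_event_prob n : forall k E x xh, is_cylinder k E ->
  (forall t, E t -> st k t = x /\ est k t = xh) ->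
  pr (E `&` error_event (k + n)) =
  pr E * iter n A (cond_err q w c sigma) (xh - x).
Proof.
elim: n => [|n IH] k E x xh cE Ex; first by rewrite addn0 (one_step_base cE Ex).
rewrite addnS -addSn iterS; apply: (one_step_transfer cE Ex).
  exact: measurable_error_event.
by move=> F y yh cF Fy; exact: IH.
Qed.

Lemma error_prob n : P (error_event n) = (iter n A (cond_err q w c sigma) xh0)%:E.
Proof.
have := error_event_prob n is_cylinder0 (x := 0) (xh := xh0)
  (fun t _ => conj erefl erefl).
rewrite setTI add0n subr0 => H.
have -> : iter n A (cond_err q w c sigma) xh0 = pr (error_event n).
  by rewrite H [X in fine X](probability_setT P) mul1r.
by rewrite fineK// fin_num_measure//; exact: measurable_error_event.
Qed.

(** Bit and decision both lie in [{0, 1}], so the squared difference is the indicator of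
    disagreement. *)
Lemma expectation_sq_err k :
  ('E_P[fun t => (((U k t)%:R - uh k t) ^+ 2)%R] = P (error_event k))%E.
Proof.
rewrite -expectation_indic; last exact: measurable_error_event.
congr expectation; apply/funext => t; rewrite indicE.
have -> : (t \in error_event k) = ((U k t)%:R != uh k t) by apply/idP/idP; rewrite inE.
rewrite /input_est decideE; case: (_ < _); case: (U k t) => /=.
- by rewrite subrr eqxx expr0n.
- by rewrite sub0r sqrrN expr1n eq_sym oner_eq0.
- by rewrite subr0 expr1n oner_eq0.
- by rewrite subrr eqxx expr0n.
Qed.

End decoding.
Theorem theorem1 (R : realType) (q w c sigma : R)
    (hq0 : 0 < q) (hq1 : q < 1) (hw : 0 < w) (hsigma : 0 < sigma)
    (d : measure_display) (T : measurableType d) (P : probability T R)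
    (U : nat -> {RV P >-> bool}) (N : nat -> {RV P >-> R})
    (hU : forall (k : nat) (A : set bool),
      distribution P (U k) A = bernoulli_prob (2^-1 : R) A)
    (hN : forall (k : nat) (A : set R), measurable A ->
      distribution P (N k.+1) A = normal_prob 0 sigma A)
    (indepU : independent_rvs P (fun k : nat => U k))
    (indepN : independent_rvs P (fun k : nat => N k.+1))
    (indepUN : independent_families P (fun k : nat => U k)
                                      (fun k : nat => N k.+1))
    (hcond :
      (4 < c ^+ 2 * w ^+ 2 / sigma ^+ 2
        /\ q < 1 / (3 + Num.sqrt (2 / (expR 1 * pi))))
      \/
      (c ^+ 2 * w ^+ 2 / sigma ^+ 2 <= 4
        /\ q <= 1 / (1 + Num.sqrt (2 / (expR 1 * pi))))) :
  exists mu : probability R R,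
    [/\ mu (error_dom q w) = 1%E,
        cvg_kantorovich (error_dom q w)
          (fun k x => error_kernel_iter q w c sigma k x) mu,
        forall nu : probability R R, nu (error_dom q w) = 1%E ->
          cvg_kantorovich (error_dom q w)
            (fun k x => error_kernel_iter q w c sigma k x) nu ->
          forall A : set R, measurable A -> nu A = mu A
      & forall xh0 : R,
          (forall t : T, error_dom q w
             (err q w c (fun k : nat => U k) (fun k : nat => N k) xh0 0 t)) ->
          mse q w c U N xh0 K @[K --> \oo] -->
            (\int[mu]_(z in error_dom q w) (cond_err q w c sigma z)%:E)%E].
Proof.
have [mu [muD muE cmu umu]] := stationary_measure c hq0 hq1 hw hsigma.
(* The initial state is 0 and the initial estimate is deterministic, so a single sample point shows
   that [xh0] lies in the interval. *)
exists mu; split => // xh0 /(_ point); rewrite /err/= subr0 => /domP xb.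
have lg := @lipb_cond_err R q w c sigma hsigma.
rewrite (intfE (radius_gt0 hq1 hw) muD lg) muE//.
pose u k := iter k (transfer q w (prob_up q w c sigma) (prob_down q w c sigma))
  (cond_err q w c sigma) xh0.
have mseE K : mse q w c U N xh0 K = (K%:R^-1 * series u K)%:E.
  rewrite /mse EFinM; congr (_ * _)%E; rewrite -sumEFin; apply: eq_bigr => k _.
  rewrite (expectation_sq_err q w c U N xh0).
  exact: (error_prob q w c hsigma xh0 hU hN indepU indepN indepUN).
under eq_fun do rewrite mseE.
apply: cvg_EFin; first by exact: nearW.
(* Cesaro means are normalised by [K.+1]; the shift discards the degenerate average at [K = 0]. *)
rewrite -cvg_shiftS; apply: cesaro; apply/cvgrPdist_le => e e0.
have [L L0 gL] := lg.
(* The closeness estimate is scaled by the Lipschitz constant of [cond_err], and [L + 1] again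
   allows [L = 0]. *)
have eL0 : 0 < e / (L + 1) by rewrite divr_gt0// ltr_wpDl.
have [k0 Hk] := error_mean_close c hq0 hq1 hw hsigma eL0.
exists k0 => // k /= kk0; rewrite distrC.
apply: le_trans (Hk _ _ _ kk0 L0 gL _ xb) _.
by rewrite -mulrA ler_piMr ?(ltW e0)// mulrC ler_pdivrMr ?mul1r ?lerDl ?ltr_wpDl.
Qed.
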